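(* Let $m\ge 3$ be an integer and $x,y\in\mathbb{R}^m$. Then the Clifford-Fourier kernel $K_{m}(x,y)=e^{i\frac{\pi}{2}\Gamma_{y}}e^{-i(x,y)}$ is given by \begin{align*} K_{m}(x,y)=&\frac{e^{-(x,y)}}{2}-\frac{|x||y|}{2}\int_{0}^{1}(1-u^{2})^{-1/2}J_{1}\big[|x||y|(1-u^{2})^{1/2}\big]u^{m/2-1}e^{-(x,y)u}\,du\\ &+\frac{m-2}{4}\int_{0}^{1}J_{0}\big[|x||y|(1-u^{2})^{1/2}\big]u^{m/2-2}e^{-(x,y)u}\,du +\frac{1}{2}\int_{0}^{1}(x\wedge y)J_{0}\big[|x||y|(1-u^{2})^{1/2}\big]u^{m/2-1}e^{-(x,y)u}\,du\\ &-e^{im\pi /2}\Big(\frac{e^{(x,y)}}{2}-\frac{|x||y|}{2}\int_{0}^{1}(1-u^{2})^{-1/2}J_{1}\big[|x||y|(1-u^{2})^{1/2}\big]u^{m/2-1}e^{(x,y)u}\,du\\ &\qquad-\frac{m-2}{4}\int_{0}^{1}J_{0}\big[|x||y|(1-u^{2})^{1/2}\big]u^{m/2-2}e^{(x,y)u}\,du +\frac{1}{2}\int_{0}^{1}(x\wedge y)J_{0}\big[|x||y|(1-u^{2})^{1/2}\big]u^{m/2-1}e^{(x,y)u}\,du \Big). \end{align*}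
   Context: $\mathcal{C}\ell_{0,m}$ is the real Clifford algebra generated by an orthonormal basis $e_1,\dots,e_m$ of $\mathbb{R}^m$ with $e_ie_j+e_je_i=-2\delta_{ij}$, complexified as $\mathbb{C}\otimes\mathcal{C}\ell_{0,m}$; vectors are embedded via $x=\sum_j x_je_j$. $(x,y)=\sum_j x_jy_j$, $|x|$ is the Euclidean norm, and $x\wedge y:=\sum_{j<k}e_je_k(x_jy_k-x_ky_j)$. The Gamma operator is $\Gamma_{y}:=-\sum_{j<k}e_{j}e_{k}(y_{j}\partial_{y_{k}}-y_{k}\partial_{y_{j}})$ and $e^{i\frac{\pi}{2}\Gamma_y}$ its operator exponential. $J_0,J_1$ are Bessel functions of the first kind. *)

(* Defs.v *)
From mathcomp Require Import all_boot all_order all_algebra.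
From mathcomp Require Import all_classical all_reals all_analysis.
From mathcomp Require Import complex.
Set Implicit Arguments. Unset Strict Implicit. Unset Printing Implicit Defensive.
Import Order.TTheory GRing.Theory Num.Theory numFieldNormedType.Exports.
Local Open Scope ring_scope.

Local Open Scope complex_scope.
Local Open Scope classical_set_scope.
Local Open Scope ring_scope.

(* An element is given by its coordinates on the basis e_A, A subset of
   {1..m} (here 'I_m), e_A = e_{a1} ... e_{ak} with a1 < ... < ak. *)
Definition cl (R : realType) (m : nat) := {ffun {set 'I_m} -> R[i]}.

(* e_A e_B = cl_sign A B e_{A Delta B}: one sign per inversion (b < a, a in A,
   b in B) from anticommutation, and one per common index from e_j^2 = -1. *)
Definition cl_sign (R : realType) (m : nat) (A B : {set 'I_m}) : R[i] :=
  (-1) ^+ (#|[set p : 'I_m * 'I_m | (p.1 \in A) && (p.2 \in B) && (p.2 < p.1)%N]|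
           + #|A :&: B|).

Definition cl_mul (R : realType) (m : nat) (a b : cl R m) : cl R m :=
  [ffun C => \sum_(A : {set 'I_m}) \sum_(B : {set 'I_m})
     (if (A :|: B) :\: (A :&: B) == C then @cl_sign R m A B * a A * b B else 0)].

Definition cl_blade (R : realType) (m : nat) (A : {set 'I_m}) : cl R m :=
  [ffun C => (C == A)%:R].

Definition cl_e (R : realType) (m : nat) (j : 'I_m) : cl R m :=
  @cl_blade R m [set j].

Definition cl_scal (R : realType) (m : nat) (c : R[i]) : cl R m :=
  c *: @cl_blade R m finset.set0.

Definition dotp (R : realType) (m : nat) (x y : 'rV[R]_m) : R :=
  \sum_(j < m) x 0 j * y 0 j.

Definition vnorm (R : realType) (m : nat) (x : 'rV[R]_m) : R :=
  Num.sqrt (dotp x x).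

Definition wedge (R : realType) (m : nat) (x y : 'rV[R]_m) : cl R m :=
  \sum_(j < m) \sum_(k < m | (j < k)%N)
     ((x 0 j * y 0 k - x 0 k * y 0 j)%:C *: cl_mul (@cl_e R m j) (@cl_e R m k)).

Definition cl_partial (R : realType) (m : nat) (F : 'rV[R]_m -> cl R m)
  (k : 'I_m) (y : 'rV[R]_m) : cl R m :=
  [ffun A => ('D_('e_k) (fun z => complex.Re (F z A)) y)
              +i* ('D_('e_k) (fun z => complex.Im (F z A)) y)].

Definition Gamma (R : realType) (m : nat) (F : 'rV[R]_m -> cl R m)
  : 'rV[R]_m -> cl R m :=
  fun y => - \sum_(j < m) \sum_(k < m | (j < k)%N)
     cl_mul (cl_mul (@cl_e R m j) (@cl_e R m k))
       ((y 0 j)%:C *: cl_partial F k y - (y 0 k)%:C *: cl_partial F j y).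

Definition cexpi (R : realType) (t : R) : R[i] := cos t +i* sin t.

Definition cl_cvg_to (R : realType) (m : nat) (s : nat -> cl R m) (l : cl R m)
  : Prop :=
  forall A : {set 'I_m},
    ((fun n => complex.Re (s n A)) @ \oo --> (complex.Re (l A) : R)) /\
    ((fun n => complex.Im (s n A)) @ \oo --> (complex.Im (l A) : R)).

Definition plane_wave (R : realType) (m : nat) (x : 'rV[R]_m)
  : 'rV[R]_m -> cl R m :=
  fun y => @cl_scal R m (cexpi (- dotp x y)).

(* n-th partial sum of the operator exponential
   e^{i pi/2 Gamma_y} = sum_j (i pi/2)^j / j! Gamma_y^j applied to
   y |-> e^{-i(x,y)}, evaluated at y *)
Definition CF_partial (R : realType) (m : nat) (x y : 'rV[R]_m) (n : nat)
  : cl R m :=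
  \sum_(j < n) ((('i * (pi / 2)%:C) ^+ j / (j`!)%:R) *:
                  iter j (@Gamma R m) (plane_wave x) y).

Definition besselJ (R : realType) (n : nat) (z : R) : R :=
  limn (series (fun k : nat =>
    (-1) ^+ k / ((k`! * (k + n)`!)%:R) * (z / 2) ^+ (2 * k + n))).

Definition int01 (R : realType) (f : R -> R) : R :=
  Rintegral (@lebesgue_measure R) `[0%R, 1%R]%classic f.

(* Main.v *)
Require Import Defs.
From mathcomp Require Import all_boot all_order all_algebra.
From mathcomp Require Import all_classical all_reals all_analysis.
From mathcomp Require Import complex measurable_realfun ring lra zify.
Set Implicit Arguments. Unset Strict Implicit. Unset Printing Implicit Defensive.
Import Order.TTheory GRing.Theory Num.Theory numFieldNormedType.Exports.
Local Open Scope ring_scope.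
Local Open Scope complex_scope.

(** Write [s = (x,y)], [rho = |x|^2 |y|^2] and [B = x /\ y]. As
    [B^2 = s^2 - rho], the operator [Gamma_y] maps [f(s,rho) + B g(s,rho)] to
    [((m-1) s g + (s^2 - rho) g_s) + B (f_s + (m-2) g)], so the iterates
    [Gamma^n e^{-is}] are given by recursively defined coefficients of
    [s^p rho^l].  [Gamma_y] commutes with the Laplacian in [y], and
    [e^{-is}] is an eigenfunction of the latter; read off on coefficients,
    this expresses the coefficients of [rho^(l+1)] through those of [rho^l], for
    every [n] and hence for the sum over [n].  For [l = 0] the operator acts
    with the eigenvalues [-p] and [p + m - 2], whence the factors [(-1)^p] and
    [- e^{i m pi/2}] of the two halves of the kernel.  On the other side,
    expanding [J_0], [J_1] and [exp] under the integrals and using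
    [int_0^1 u^(c-1) (1-u^2)^l du = 2^l l! / (c (c+2) ... (c+2l))] yields
    coefficients with the same recursion in [l] and the same values at [l = 0].
    The bound [(2 (k+m))^n / k!] on the coefficients of degree [k] of [Gamma^n]
    allows to exchange the exponential series with the expansions in [s]
    and [rho]. *)

(** * Products of vectors in the Clifford algebra *)

(** The coefficients are computed for e^s because they are then real. [Gamma] preserves the degree
    in y, so the return to e^{-is} only multiplies the terms of degree k by (-i)^k. It also changes
    the sign on one side of the Laplace recursion, as e^{-is} has the opposite eigenvalue. The
    powers of [Gamma] have a simple closed form on s^p rho^l only for l = 0. The Laplacian dispenses
    with one for l > 0: it determines the coefficient of rho^(l+1) after division by a nonzero
    factor, in the same way for every n. Convergence of the exponential series is part of the claim.
    At fixed degree k the weights (pi/2)^n/n! sum the bound to e^{pi (k+m)}/k!. The factor e^{pi k}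
    is geometric and loses against k!, so a single majorant serves all partial sums over n, and
    dominated convergence for series applies. Under the integrals, u^{m/2-2} is unbounded at 0 when
    m = 3 and (1-u^2)^{-1/2} is unbounded at 1. The first is kept as an integrable weight; the
    second is absorbed, since J_1(z)/z is a power series in z^2. *)

Section RealComplex.
Variable R : realType.
Implicit Types a b : R.

Lemma rcD a b : (a + b)%:C = a%:C + b%:C :> R[i]. Proof. exact: rmorphD. Qed.
Lemma rcN a : (- a)%:C = - a%:C :> R[i]. Proof. exact: rmorphN. Qed.
Lemma rcB a b : (a - b)%:C = a%:C - b%:C :> R[i]. Proof. exact: rmorphB. Qed.
Lemma rcM a b : (a * b)%:C = a%:C * b%:C :> R[i]. Proof. exact: rmorphM. Qed.
Lemma rcX a n : (a ^+ n)%:C = a%:C ^+ n :> R[i]. Proof. exact: rmorphXn. Qed.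
Lemma rcn n : (n%:R : R)%:C = n%:R :> R[i]. Proof. exact: rmorph_nat. Qed.
Lemma rc_sum I (r : seq I) (P : pred I) (F : I -> R) :
  (\sum_(i <- r | P i) F i)%:C = \sum_(i <- r | P i) (F i)%:C :> R[i].
Proof. exact: rmorph_sum. Qed.

End RealComplex.

Section CliffordAlgebra.
Variables (R : realType) (m : nat).
Implicit Types (A B C : {set 'I_m}) (a b c : cl R m) (x y z : 'rV[R]_m).
Local Notation "a ** b" := (cl_mul a b) (at level 40, left associativity).

Definition symd A B : {set 'I_m} := (A :|: B) :\: (A :&: B).

Lemma in_symd A B i : (i \in symd A B) = (i \in A) (+) (i \in B).
Proof. by rewrite !inE; case: (i \in A); case: (i \in B). Qed.

Lemma symdK A : involutive (symd A).
Proof. by move=> B; apply/setP => i; rewrite !in_symd addKb. Qed.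

Lemma cl_signE A B : cl_sign R A B =
  \prod_(p : 'I_m * 'I_m) (-1) ^+ [&& p.1 \in A, p.2 \in B & (p.2 <= p.1)%N].
Proof.
rewrite prodrXr /cl_sign; congr (_ ^+ _).
rewrite (bigID (fun p : 'I_m * 'I_m => (p.2 < p.1)%N)) /=; congr (_ + _)%N.
  (* The inversions counted by [cl_sign] form a classical set; a boolean predicate replaces it
     before counting. *)
  rewrite (eq_card (B := [pred p : 'I_m * 'I_m | (p.1 \in A) && (p.2 \in B)
      && (p.2 < p.1)%N])) => [|p]; last by apply/asboolP/idP.
  rewrite -sum1_card big_mkcond [RHS]big_mkcond /=; apply: eq_bigr => -[i j] _ /=.
  by rewrite inE /=; case: ltnP => [/ltnW ->|_]; case: (i \in A); case: (j \in B).
rewrite -sum1_card big_mkcond [RHS]big_mkcond /=.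
rewrite -(pair_bigA _ (fun i j : 'I_m => if ~~ (j < i)%N then
   nat_of_bool [&& i \in A, j \in B & (j <= i)%N] else 0%N)) /=.
apply: eq_bigr => i _; rewrite (bigD1 i) //= big1 ?addn0 => [|j ji].
  by rewrite !inE ltnn leqnn /=; case: (i \in A); case: (i \in B).
rewrite -leqNgt leq_eqVlt eq_sym -[_ == _ :> nat]/(j == i) (negPf ji) /=.
by case: ltnP => //; case: (i \in A); case: (j \in B) => //=; rewrite leqNgt => ->.
Qed.

(* The exponent of the sign is #|{(i, j) in A x B | j <= i}|, which is
   bilinear modulo 2 for the symmetric difference. *)
Lemma cl_sign_symdl A B C :
  cl_sign R (symd A B) C = cl_sign R A C * cl_sign R B C.
Proof.
rewrite !cl_signE -big_split; apply: eq_bigr => -[i j] _ /=.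
rewrite in_symd; case: (i \in A); case: (i \in B); case: ((j \in C) && _) => //=;
  by rewrite ?expr0 ?expr1 ?mulrNN ?mulr1 ?mul1r.
Qed.

Lemma cl_sign_symdr A B C :
  cl_sign R A (symd B C) = cl_sign R A B * cl_sign R A C.
Proof.
rewrite !cl_signE -big_split; apply: eq_bigr => -[i j] _ /=.
rewrite in_symd; case: (i \in A); case: (j \in B); case: (j \in C); case: (_ <= _)%N => //=;
  by rewrite ?expr0 ?expr1 ?mulrNN ?mulr1 ?mul1r.
Qed.

Lemma cl_mulE a b C :
  (a ** b) C = \sum_A cl_sign R A (symd A C) * a A * b (symd A C).
Proof.
rewrite ffunE; apply: eq_bigr => A _.
rewrite (bigD1 (symd A C)) //= big1 ?addr0 => [|B neqB].
  by rewrite -/(symd _ _) symdK eqxx.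
rewrite -/(symd _ _); case: eqP => // E; case/eqP: neqB.
by rewrite -E symdK.
Qed.

(** Reindexing one sum by B -> A Delta B makes the two double sums agree termwise; the signs match
    because [cl_sign] is bilinear, hence a 2-cocycle. *)
Lemma cl_mulA a b c : a ** (b ** c) = a ** b ** c.
Proof.
apply/ffunP => D; rewrite !cl_mulE.
under eq_bigr do rewrite cl_mulE mulr_sumr.
under [RHS]eq_bigr do rewrite cl_mulE mulr_sumr mulr_suml.
rewrite [RHS]exchange_big; apply: eq_bigr => A _ /=.
rewrite [RHS](reindex_inj (inv_inj (@symdK A))) /=.
apply: eq_bigr => B _; rewrite symdK.
have E : symd B (symd A D) = symd (symd A B) D.
  by apply/setP => i; rewrite !in_symd addbCA addbA.
rewrite E cl_sign_symdl -[in cl_sign R A (symd A D)](symdK B (symd A D)).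
by rewrite cl_sign_symdr E; ring.
Qed.

Lemma cl_mulDl a b c : (a + b) ** c = a ** c + b ** c.
Proof.
apply/ffunP => D; rewrite !ffunE -big_split; apply: eq_bigr => A _ /=.
rewrite -big_split; apply: eq_bigr => B _ /=; rewrite ffunE.
by case: ifP => _; [ring|rewrite addr0].
Qed.

Lemma cl_mulDr a b c : a ** (b + c) = a ** b + a ** c.
Proof.
apply/ffunP => D; rewrite !ffunE -big_split; apply: eq_bigr => A _ /=.
rewrite -big_split; apply: eq_bigr => B _ /=; rewrite ffunE.
by case: ifP => _; [ring|rewrite addr0].
Qed.

Lemma cl_mulZl k a b : (k *: a) ** b = k *: (a ** b).
Proof.
apply/ffunP => D; rewrite !ffunE scaler_sumr; apply: eq_bigr => A _ /=.
rewrite scaler_sumr; apply: eq_bigr => B _ /=; rewrite ffunE /GRing.scale /=.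
by case: ifP => _; [ring|rewrite mulr0].
Qed.

Lemma cl_mulZr k a b : a ** (k *: b) = k *: (a ** b).
Proof.
apply/ffunP => D; rewrite !ffunE scaler_sumr; apply: eq_bigr => A _ /=.
rewrite scaler_sumr; apply: eq_bigr => B _ /=; rewrite ffunE /GRing.scale /=.
by case: ifP => _; [ring|rewrite mulr0].
Qed.

Lemma cl_mulNl a b : (- a) ** b = - (a ** b).
Proof. by rewrite -scaleN1r cl_mulZl scaleN1r. Qed.

Lemma cl_mulNr a b : a ** (- b) = - (a ** b).
Proof. by rewrite -scaleN1r cl_mulZr scaleN1r. Qed.

Lemma cl_mul0l a : 0 ** a = 0.
Proof. by move: (cl_mulZl 0 0 a); rewrite !scale0r. Qed.

Lemma cl_mul0r a : a ** 0 = 0.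
Proof. by move: (cl_mulZr 0 a 0); rewrite !scale0r. Qed.

Lemma cl_mul_suml I (r : seq I) (P : pred I) (F : I -> cl R m) a :
  (\sum_(i <- r | P i) F i) ** a = \sum_(i <- r | P i) F i ** a.
Proof.
by apply: (big_morph (fun b => b ** a)) => [b c|]; rewrite ?cl_mulDl ?cl_mul0l.
Qed.

Lemma cl_mul_sumr I (r : seq I) (P : pred I) (F : I -> cl R m) a :
  a ** (\sum_(i <- r | P i) F i) = \sum_(i <- r | P i) a ** F i.
Proof.
by apply: (big_morph (fun b => a ** b)) => [b c|]; rewrite ?cl_mulDr ?cl_mul0r.
Qed.

Lemma cl_mul_blade A B :
  cl_blade R A ** cl_blade R B = cl_sign R A B *: cl_blade R (symd A B).
Proof.
apply/ffunP => D; rewrite cl_mulE (bigD1 A) //= big1 ?addr0 => [|C neqC].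
  rewrite !ffunE eqxx mulr1 [RHS]/GRing.scale /=.
  have [->|neqD] := eqVneq D (symd A B); first by rewrite symdK eqxx.
  case: eqP => [E|_]; last by rewrite !mulr0n !mulr0.
  by case/eqP: neqD; rewrite -E symdK.
by rewrite ffunE (negPf neqC) mulr0 mul0r.
Qed.

Lemma cl_mul1l a : cl_blade R finset.set0 ** a = a.
Proof.
apply/ffunP => D; rewrite cl_mulE (bigD1 finset.set0) //= big1 ?addr0 => [|C neqC].
  rewrite ffunE eqxx mulr1 cl_signE big1 ?mul1r => [|p _]; last by rewrite inE.
  by congr (a _); apply/setP => i; rewrite in_symd inE.
by rewrite ffunE (negPf neqC) mulr0 mul0r.
Qed.

Lemma cl_mul1r a : a ** cl_blade R finset.set0 = a.
Proof.
apply/ffunP => D; rewrite cl_mulE (bigD1 D) //= big1 ?addr0 => [|C neqC].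
  have -> : symd D D = finset.set0 by apply/setP => i; rewrite in_symd addbb inE.
  rewrite ffunE eqxx mulr1 cl_signE big1 ?mul1r => [//|p _].
  by rewrite inE /= andbF.
rewrite ffunE; case: eqP => [E|]; last by rewrite mulr0.
case/eqP: neqC; rewrite -(symdK C D) E.
by apply/setP => i; rewrite in_symd inE addbF.
Qed.

Local Notation e := (@cl_e R m).
Local Notation one := (cl_blade R (@finset.set0 'I_m)).

Lemma cl_e_sq j : e j ** e j = - one.
Proof.
rewrite cl_mul_blade cl_signE (bigD1 (j, j)) //= !inE eqxx leqnn.
rewrite big1 => [|[i k]]; last first.
  rewrite /= xpair_eqE !inE => /nandP[] /negPf ->; by rewrite /= ?andbF.
rewrite mulr1 scaleN1r; congr (- cl_blade R _).
by apply/setP => i; rewrite in_symd addbb inE.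
Qed.

Lemma cl_e_anticomm j k : j != k -> e j ** e k = - (e k ** e j).
Proof.
wlog lt_jk : j k / (j < k)%N => [th jk|jk].
  have := jk; rewrite neq_ltn => /orP[] lt; first exact: th.
  by rewrite (th k j) ?opprK // eq_sym.
rewrite !cl_mul_blade.
have -> : symd [set k] [set j] = symd [set j] [set k].
  by apply/setP => i; rewrite !in_symd addbC.
suff [-> ->] : cl_sign R [set j] [set k] = 1 /\ cl_sign R [set k] [set j] = -1.
  by rewrite scale1r scaleN1r opprK.
split; rewrite cl_signE.
  rewrite big1 // => -[i l] _ /=; rewrite !inE.
  by case: eqP => [->|_] //=; case: eqP => [->|_] //=; rewrite leqNgt lt_jk.
rewrite (bigD1 (k, j)) //= !inE !eqxx (ltnW lt_jk).
rewrite big1 ?mulr1 => [//|[i l]].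
rewrite /= xpair_eqE !inE => /nandP[] /negPf ->; by rewrite /= ?andbF.
Qed.

Definition cl_vec x : cl R m := \sum_j (x 0 j)%:C *: e j.

Lemma sum_diag_upper (V : zmodType) (F : 'I_m -> 'I_m -> V) :
  \sum_j \sum_k F j k =
  \sum_j F j j + \sum_(j < m) \sum_(k < m | (j < k)%N) (F j k + F k j).
Proof.
under [in X in _ + X]eq_bigr do rewrite big_split.
rewrite big_split /= [X in _ + (_ + X)](exchange_big_dep predT) //= addrA.
rewrite -!big_split /=; apply: eq_bigr => j _.
rewrite (bigD1 j) //= -addrA; congr (_ + _).
rewrite (bigID (fun k : 'I_m => (j < k)%N)) /=; congr (_ + _); apply: eq_bigl => k.
  by rewrite -val_eqE /=; case: ltngtP.
by rewrite -leqNgt ltn_neqAle -val_eqE.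
Qed.

Lemma wedgeC x y : wedge y x = - wedge x y.
Proof.
rewrite /wedge -sumrN; apply: eq_bigr => j _; rewrite -sumrN.
apply: eq_bigr => k _; rewrite -[RHS]scaleNr -rcN; congr (_%:C *: _).
by rewrite opprB; congr (_ - _); rewrite mulrC.
Qed.

Lemma dotpC x y : dotp x y = dotp y x.
Proof. by apply: eq_bigr => j _; rewrite mulrC. Qed.

(** Off the diagonal, the terms jk and kj merge by anticommutation into the bivector; the diagonal
    contributes e_j^2 = -1. *)
Lemma cl_vecM x y : cl_vec x ** cl_vec y = wedge x y - (dotp x y)%:C *: one.
Proof.
rewrite cl_mul_suml; under eq_bigr do rewrite cl_mul_sumr.
rewrite sum_diag_upper addrC; congr (_ + _).
  apply: eq_bigr => j _; apply: eq_bigr => k jk.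
  rewrite !cl_mulZl !cl_mulZr !scalerA (@cl_e_anticomm k j); last first.
    by rewrite -val_eqE /= gtn_eqF.
  rewrite scalerN -scalerBl; congr (_ *: _).
  by rewrite -!rcM -rcB.
rewrite /dotp rc_sum scaler_suml -sumrN; apply: eq_bigr => j _.
by rewrite cl_mulZl cl_mulZr cl_e_sq !scalerN scalerA -rcM.
Qed.

Lemma wedgeE x y : wedge x y = cl_vec x ** cl_vec y + (dotp x y)%:C *: one.
Proof. by rewrite cl_vecM subrK. Qed.

Lemma cl_vec_anticomm x y :
  cl_vec y ** cl_vec x = - (cl_vec x ** cl_vec y) - (2 * dotp x y)%:C *: one.
Proof.
rewrite !cl_vecM wedgeC (dotpC y x) opprB.
have -> : (2 * dotp x y)%:C *: one = (dotp x y)%:C *: one + (dotp x y)%:C *: one.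
  by rewrite mulr2n mulrDl mul1r rcD scalerDl.
by rewrite opprD addrA [X in _ = X - _]addrAC subrr add0r.
Qed.

(** One factor B is written as xy + s, the other as -yx - s; then xyyx collapses to |x|^2 |y|^2,
    since vectors square to scalars. *)
Lemma wedge_sq x y :
  wedge x y ** wedge x y = (dotp x y ^+ 2 - dotp x x * dotp y y)%:C *: one.
Proof.
have vsq z : cl_vec z ** cl_vec z = - (dotp z z)%:C *: one.
  rewrite cl_vecM scaleNr [wedge z z]big1 ?add0r // => j _.
  by rewrite big1 // => k _; rewrite mulrC subrr scale0r.
have BE : wedge x y = - (cl_vec y ** cl_vec x) - (dotp x y)%:C *: one.
  by rewrite cl_vecM (wedgeC x y) (dotpC y x) opprB opprK addrAC subrr add0r.
have BYX : wedge x y ** (cl_vec y ** cl_vec x) =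
    (dotp x x * dotp y y)%:C *: one + (dotp x y)%:C *: (cl_vec y ** cl_vec x).
  rewrite wedgeE cl_mulDl cl_mulZl cl_mul1l; congr (_ + _).
  rewrite cl_mulA -(cl_mulA (cl_vec x)) vsq cl_mulZr cl_mul1r cl_mulZl vsq.
  by rewrite scalerA; congr (_ *: _); rewrite mulrNN mulrC -rcM.
rewrite {2}BE cl_mulDr !cl_mulNr cl_mulZr cl_mul1r BYX BE.
rewrite scalerBr scalerN scalerA -rcM opprB opprK opprD.
rewrite expr2 rcB scalerBl; set P := (dotp x x * _)%:C *: one.
set S := (dotp x y * _)%:C *: one; set Q := _ *: (cl_vec y ** _).
move: P S Q => P S Q.
rewrite (addrC S Q) addrA subrK; exact: addrC.
Qed.

Lemma cl_vec_delta k : cl_vec ('e_k) = e k.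
Proof.
rewrite /cl_vec (bigD1 k) //= big1 ?addr0 => [|j jk].
  by rewrite mxE !eqxx scale1r.
by rewrite mxE (negPf jk) andbF scale0r.
Qed.

Lemma cl_e_vec_e x k :
  e k ** (cl_vec x ** e k) = cl_vec x - (2 * x 0 k)%:C *: e k.
Proof.
have -> : cl_vec x ** e k = - (e k ** cl_vec x) - (2 * x 0 k)%:C *: one.
  rewrite -cl_vec_delta (cl_vec_anticomm _ x); congr (_ - (2 * _)%:C *: _).
  rewrite /dotp (bigD1 k) //= big1 ?addr0 => [|j jk].
    by rewrite mxE !eqxx mul1r.
  by rewrite mxE (negPf jk) andbF mul0r.
rewrite cl_mulDr !cl_mulNr cl_mulZr cl_mul1r cl_mulA cl_e_sq cl_mulNl cl_mul1l.
by rewrite opprK.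
Qed.

(** Source of the constant m - 2 in the action of [Gamma]: conjugation by e_k changes x only along
    e_k. *)
Lemma sum_cl_e_vec_e x : \sum_k e k ** (cl_vec x ** e k) = (m%:R - 2) *: cl_vec x.
Proof.
under eq_bigr do rewrite cl_e_vec_e.
rewrite big_split /= sumr_const card_ord sumrN scalerBl scaler_nat; congr (_ - _).
rewrite /cl_vec scaler_sumr; apply: eq_bigr => j _.
by rewrite scalerA rcM rcn.
Qed.

(** The left side is -[Gamma] of B itself, as the k-th partial derivative of x /\ y in y is x /\
    e_k. With the diagonal terms added, the sum factors as y times the sum of the e_k (x /\ e_k),
    and the latter is (m-1) x. *)
Lemma sum_ee_wedge x y :
  \sum_(j < m) \sum_(k < m | (j < k)%N) e j ** e k **
     ((y 0 j)%:C *: wedge x 'e_k - (y 0 k)%:C *: wedge x 'e_j) =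
  - (((m%:R - 1) * (dotp x y)%:C) *: one + (m%:R - 2) *: wedge x y).
Proof.
pose F j k := (y 0 j)%:C *: (e j ** e k ** wedge x 'e_k).
have dx k : dotp x 'e_k = x 0 k.
  rewrite /dotp (bigD1 k) //= big1 ?addr0 => [|j jk].
    by rewrite mxE !eqxx mulr1.
  by rewrite mxE (negPf jk) andbF mulr0.
transitivity (\sum_j \sum_k F j k - \sum_j F j j).
  rewrite sum_diag_upper addrC addKr; apply: eq_bigr => j _; apply: eq_bigr => k jk.
  rewrite cl_mulDr cl_mulNr !cl_mulZr /F (@cl_e_anticomm k j).
    by rewrite cl_mulNl scalerN.
  by rewrite -val_eqE /= gtn_eqF.
have diagE : \sum_j F j j = - wedge x y.
  rewrite wedgeE cl_mul_sumr /dotp rc_sum scaler_suml -big_split -sumrN.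
  apply: eq_bigr => j _ /=; rewrite /F cl_e_sq cl_mulNl cl_mul1l scalerN.
  rewrite wedgeE cl_vec_delta dx scalerDr scalerA -rcM [y 0 j * _]mulrC.
  by rewrite cl_mulZr.
have -> : \sum_j \sum_k F j k = (m%:R - 1) *: (cl_vec y ** cl_vec x).
  have -> : (m%:R - 1) *: (cl_vec y ** cl_vec x) =
      cl_vec y ** \sum_k e k ** wedge x 'e_k.
    have -> : \sum_k e k ** wedge x 'e_k = (m%:R - 2) *: cl_vec x + cl_vec x.
      rewrite -sum_cl_e_vec_e -big_split; apply: eq_bigr => k _ /=.
      by rewrite wedgeE cl_vec_delta dx cl_mulDr cl_mulZr cl_mul1r.
    rewrite cl_mulDr cl_mulZr -{3}(scale1r (cl_vec y ** _)) -scalerDl.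
    by congr (_ *: _); ring.
  rewrite cl_mul_suml; apply: eq_bigr => j _; rewrite cl_mulZl cl_mul_sumr.
  by rewrite scaler_sumr; apply: eq_bigr => k _; rewrite /F cl_mulA.
rewrite diagE cl_vecM (wedgeC x y) (dotpC y x) opprK -opprD scalerN addrC scalerDr scalerA.
set P := _ *: one.
rewrite opprD addrA [RHS]opprD [RHS]addrC; congr (_ - _).
by rewrite -[X in X - _]scale1r -scalerBl -scaleNr; congr (_ *: _); ring.
Qed.

End CliffordAlgebra.

Local Open Scope classical_set_scope.
Local Open Scope ring_scope.

(** * Action of the Gamma operator on scalar plus bivector fields *)

Section GammaAction.
Variables (R : realType) (m : nat).
Implicit Types (x y z v : 'rV[R]_m) (f g : 'rV[R]_m -> R[i]).
Local Notation "a ** b" := (cl_mul a b) (at level 40, left associativity).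
Local Notation one := (cl_blade R (@finset.set0 'I_m)).

Lemma is_derive_additive (f : 'rV[R]_m -> R) y v :
  (forall h, f (h *: v + y) = h * f v + f y) -> is_derive y v f (f v).
Proof.
move=> fl.
have fv : h^-1 *: (f (h *: v + y) - f y) @[h --> 0^'] --> f v.
  apply: cvg_near_cst; near=> h.
  rewrite fl addrK /GRing.scale /= mulKf //; near: h.
  exact: nbhs_dnbhs_neq.
by apply: DeriveDef; [apply/cvg_ex; exists (f v)|exact: cvg_lim].
Unshelve. all: by end_near. Qed.

Lemma cReD (a b : R[i]) : complex.Re (a + b) = complex.Re a + complex.Re b.
Proof. by case: a b => ? ? []. Qed.

Lemma cImD (a b : R[i]) : complex.Im (a + b) = complex.Im a + complex.Im b.
Proof. by case: a b => ? ? []. Qed.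

Lemma cReM (a b : R[i]) : complex.Re (a * b) =
  complex.Re a * complex.Re b - complex.Im a * complex.Im b.
Proof. by case: a b => ? ? []. Qed.

Lemma cImM (a b : R[i]) : complex.Im (a * b) =
  complex.Re a * complex.Im b + complex.Im a * complex.Re b.
Proof. by case: a b => ? ? []. Qed.

(** Componentwise, to match [cl_partial], which differentiates real and imaginary parts
    separately. *)
Definition is_cderive f y v (d : R[i]) :=
  is_derive y v (fun z => complex.Re (f z)) (complex.Re d) /\
  is_derive y v (fun z => complex.Im (f z)) (complex.Im d).

Lemma is_cderiveD f g y v d e : is_cderive f y v d -> is_cderive g y v e ->
  is_cderive (fun z => f z + g z) y v (d + e).
Proof.
move=> [f1 f2] [g1 g2]; split.
  have -> : (fun z => complex.Re (f z + g z)) =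
    (fun z => complex.Re (f z)) \+ (fun z => complex.Re (g z)).
    by apply/funext => z /=; rewrite raddfD.
  by rewrite raddfD; exact: is_deriveD.
have -> : (fun z => complex.Im (f z + g z)) =
  (fun z => complex.Im (f z)) \+ (fun z => complex.Im (g z)).
  by apply/funext => z /=; rewrite raddfD.
by rewrite raddfD; exact: is_deriveD.
Qed.

Lemma is_cderiveM f g y v d e : is_cderive f y v d -> is_cderive g y v e ->
  is_cderive (fun z => f z * g z) y v (d * g y + f y * e).
Proof.
move=> [f1 f2] [g1 g2]; split.
  have -> : (fun z => complex.Re (f z * g z)) =
    ((fun z => complex.Re (f z)) * (fun z => complex.Re (g z)) -
     (fun z => complex.Im (f z)) * (fun z => complex.Im (g z))).
    by apply/funext => z /=; rewrite cReM.
  apply: is_derive_eq; rewrite cReD !cReM /GRing.scale /=; ring.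
have -> : (fun z => complex.Im (f z * g z)) =
    ((fun z => complex.Re (f z)) * (fun z => complex.Im (g z)) +
     (fun z => complex.Im (f z)) * (fun z => complex.Re (g z))).
  by apply/funext => z /=; rewrite cImM.
apply: is_derive_eq; rewrite cImD !cImM /GRing.scale /=; ring.
Qed.

Lemma wedge_additive x h v y :
  wedge x (h *: v + y) = h%:C *: wedge x v + wedge x y.
Proof.
rewrite /wedge scaler_sumr -big_split; apply: eq_bigr => j _ /=.
rewrite scaler_sumr -big_split; apply: eq_bigr => k _ /=.
rewrite !mxE scalerA -scalerDl -rcM -rcD; congr (_%:C *: _); ring.
Qed.

Lemma is_cderive_wedge x y v A :
  is_cderive (fun z => wedge x z A) y v (wedge x v A).
Proof.
split; apply: is_derive_additive => h; rewrite wedge_additive ffunE raddfD ffunE;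
 by case: (wedge x v A) => a b /=; simpc.
Qed.

Lemma is_cderive_cst (c : R[i]) y v : is_cderive (fun=> c) y v 0.
Proof. by split; exact: is_derive_cst. Qed.

Lemma cl_partialE (F : 'rV[R]_m -> cl R m) k y (D : cl R m) :
  (forall A, is_cderive (fun z => F z A) y 'e_k (D A)) -> cl_partial F k y = D.
Proof.
move=> FD; apply/ffunP => A; rewrite ffunE; have [F1 F2] := FD A.
by rewrite !derive_val; case: (D A).
Qed.

(** Gradients are split along x and y. The part along y, coming from rho, is annihilated by the
    rotation fields y_j d_k - y_k d_j, so [f2] and [g2] drop out; the part along x yields
    multiplication by B, and B^2 = s^2 - rho. *)
Lemma Gamma_bivector x y f g (f1 f2 g1 g2 : R[i]) :
  (forall k, is_cderive f y 'e_k (f1 * (x 0 k)%:C + f2 * (y 0 k)%:C)) ->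
  (forall k, is_cderive g y 'e_k (g1 * (x 0 k)%:C + g2 * (y 0 k)%:C)) ->
  Gamma (fun z => cl_scal m (f z) + g z *: wedge x z) y =
  cl_scal m ((m%:R - 1) * (dotp x y)%:C * g y +
    (dotp x y ^+ 2 - dotp x x * dotp y y)%:C * g1) +
  (f1 + (m%:R - 2) * g y) *: wedge x y.
Proof.
move=> fD gD.
have partialE k : cl_partial (fun z => cl_scal m (f z) + g z *: wedge x z) k y =
    (f1 * (x 0 k)%:C + f2 * (y 0 k)%:C) *: one +
    (g1 * (x 0 k)%:C + g2 * (y 0 k)%:C) *: wedge x y + g y *: wedge x 'e_k.
  apply: cl_partialE => A.
  have -> : (fun z => (cl_scal m (f z) + g z *: wedge x z) A) =
            (fun z => f z * one A + g z * wedge x z A).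
    by apply/funext => z; rewrite !ffunE.
  rewrite -addrA 4!ffunE; apply: is_cderiveD.
    have := is_cderiveM (fD k) (is_cderive_cst (one A) y 'e_k).
    by rewrite mulr0 addr0 ffunE.
  have := is_cderiveM (gD k) (is_cderive_wedge x y 'e_k A).
  by rewrite !ffunE.
rewrite /Gamma.
have stepE j k : (y 0 j)%:C *: cl_partial (fun z => cl_scal m (f z) + g z *: wedge x z) k y -
    (y 0 k)%:C *: cl_partial (fun z => cl_scal m (f z) + g z *: wedge x z) j y =
    - (x 0 j * y 0 k - x 0 k * y 0 j)%:C *: (f1 *: one + g1 *: wedge x y) +
    g y *: ((y 0 j)%:C *: wedge x 'e_k - (y 0 k)%:C *: wedge x 'e_j).
  rewrite !partialE; apply/ffunP => A; rewrite !ffunE /GRing.scale /= rcB !rcM.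
  ring.
under eq_bigr do under eq_bigr do rewrite stepE cl_mulDr !cl_mulZr.
under eq_bigr do rewrite big_split /= -scaler_sumr.
rewrite big_split /= -scaler_sumr sum_ee_wedge.
have -> : \sum_(j < m) \sum_(k < m | (j < k)%N)
    - (x 0 j * y 0 k - x 0 k * y 0 j)%:C *:
      (cl_e R j ** cl_e R k ** (f1 *: one + g1 *: wedge x y)) =
    - (wedge x y ** (f1 *: one + g1 *: wedge x y)).
  rewrite {2}/wedge cl_mul_suml -sumrN; apply: eq_bigr => j _.
  rewrite cl_mul_suml -sumrN; apply: eq_bigr => k _.
  by rewrite cl_mulZl scaleNr.
rewrite cl_mulDr !cl_mulZr cl_mul1r wedge_sq /cl_scal.
apply/ffunP => A; rewrite !ffunE /GRing.scale /=; ring.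
Qed.

End GammaAction.

(** * Coefficients of the iterates of Gamma *)

Section Coefficients.
Variables (R : realType) (m : nat).

Definition lag (u : nat -> R) (k : nat) : R := if k is k'.+1 then u k' else 0.

(* [scal_coef n l p] and [biv_coef n l p] are the coefficients of [s^p rho^l]
   in [f] and [g], where [Gamma^n e^s = f + B g]. *)
Fixpoint gamma_coef n : (nat -> nat -> R) * (nat -> nat -> R) :=
  if n is n'.+1 then
    let: (a, b) := gamma_coef n' in
    (fun l p => (m%:R - 2 + p%:R) * lag (b l) p - p.+1%:R * lag (b^~ p.+1) l,
     fun l p => p.+1%:R * a l p.+1 + (m%:R - 2) * b l p)
  else (fun l p => (l == 0)%:R / p`!%:R, fun=> fun=> 0).

Definition scal_coef n := (gamma_coef n).1.
Definition biv_coef n := (gamma_coef n).2.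

Lemma scal_coef0 l p : scal_coef 0 l p = (l == 0)%:R / p`!%:R. Proof. by []. Qed.
Lemma biv_coef0 l p : biv_coef 0 l p = 0. Proof. by []. Qed.

(** The factor m - 2 + p collects m - 1 from s g and p - 1 from s^2 g_s; the lag in [l] is the
    multiplication by rho. *)
Lemma scal_coefS n l p : scal_coef n.+1 l p =
  (m%:R - 2 + p%:R) * lag (biv_coef n l) p - p.+1%:R * lag ((biv_coef n)^~ p.+1) l.
Proof. by rewrite /scal_coef /biv_coef /=; case: (gamma_coef n). Qed.

Lemma biv_coefS n l p : biv_coef n.+1 l p =
  p.+1%:R * scal_coef n l p.+1 + (m%:R - 2) * biv_coef n l p.
Proof. by rewrite /scal_coef /biv_coef /=; case: (gamma_coef n). Qed.

(* [Gamma^n] commutes with the Laplacian [Delta_y / |x|^2], which fixes [e^s]. *)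
Lemma coef_laplace n l p :
  p.+2%:R * p.+1%:R * scal_coef n l p.+2 +
    2 * l.+1%:R * (2 * l%:R + m%:R + 2 * p%:R) * scal_coef n l.+1 p = scal_coef n l p /\
  p.+2%:R * p.+1%:R * biv_coef n l p.+2 +
    2 * l.+1%:R * (2 * l%:R + 2 + m%:R + 2 * p%:R) * biv_coef n l.+1 p = biv_coef n l p.
Proof.
elim: n l p => [|n IH] l p.
  rewrite !scal_coef0 !biv_coef0 !mulr0 addr0; split => //=.
  rewrite mul0r mulr0 addr0; case: l => [|l] /=; last by rewrite !mul0r mulr0.
  have p0 : (p`!%:R : R) != 0 by rewrite pnatr_eq0 -lt0n fact_gt0.
  have p1 : (p%:R + 1 : R) != 0 by rewrite natr1 pnatr_eq0.
  have p2 : (p%:R + 1 + 1 : R) != 0 by rewrite !natr1 pnatr_eq0.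
  by rewrite !factS !natrM -!natr1; field; rewrite p0 p1 p2.
split.
  (* The lagged terms call for the hypothesis at [l.-1] and at [p.-1]; where an index is 0, the lag
     supplies 0 and the case is checked separately. *)
  rewrite !scal_coefS; have [_ IH1] := IH l.-1 p.+1; have [_ IH2] := IH l p.-1.
  case: l IH1 IH2 => [|l]; case: p => [|p] /= IH1 IH2.
  - by rewrite -!natr1 !mulr0n; ring.
  - rewrite -IH2; rewrite -!natr1; ring.
  - rewrite -IH1; rewrite -!natr1; ring.
  - rewrite -IH1 -IH2; rewrite -!natr1; ring.
rewrite !biv_coefS; have [IH1 _] := IH l p.+1; have [_ IH2] := IH l p.
rewrite -IH1 -IH2; rewrite -!natr1; ring.
Qed.

Hypothesis hm : (2 < m)%N.

(** For l = 0 and p > 0 the recursion closes on the pair ([scal_coef n 0 p], [biv_coef n 0 p.-1]),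
    with a 2 by 2 matrix of trace m - 2 and determinant -p (p + m - 2). These are its powers applied
    to (1/p!, 0); the denominator m - 2 + 2p is the gap between the eigenvalues. *)
Lemma coef_l0 n p :
  scal_coef n 0 p =
    ((m%:R - 2 + p%:R) * (- p%:R) ^+ n + p%:R * (m%:R - 2 + p%:R) ^+ n)
      / ((m%:R - 2 + 2 * p%:R) * p`!%:R) /\
  biv_coef n 0 p =
    ((m%:R - 2 + p.+1%:R) ^+ n - (- p.+1%:R) ^+ n) /
      ((m%:R - 2 + 2 * p.+1%:R) * p`!%:R).
Proof.
have p0 k : (k`!%:R : R) != 0 by rewrite pnatr_eq0 -lt0n fact_gt0.
have m2 : 0 < (m%:R - 2 : R) by rewrite subr_gt0 ltr_nat.
have mp k : (m%:R - 2 + 2 * k%:R : R) != 0.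
  by rewrite gt_eqF // ltr_pwDl // mulr_ge0.
elim: n p => [|n IH] p.
  rewrite scal_coef0 biv_coef0 !expr0 subrr mul0r; split => //.
  by rewrite eqxx mulr1n; field; rewrite p0 mp.
rewrite scal_coefS biv_coefS /= mulr0 subr0 (IH p.+1).1 (IH p).2; split.
  case: p => [|p] /=.
    by rewrite oppr0 expr0n /= !mulr0 mul0r addr0 mul0r.
  rewrite (IH p).2 factS natrM !exprS.
  have := mp p.+1; have : (p.+1%:R : R) != 0 by rewrite pnatr_eq0.
  move: (_ ^+ n) (_ ^+ n) (p0 p) => P Q.
  move: (m%:R) (p.+1%:R) (p`!%:R) => M K F n1 n2 n3; field.
  by rewrite n1 n2 n3.
have := mp p.+1; have : (p.+1%:R : R) != 0 by rewrite pnatr_eq0.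
rewrite factS natrM !exprS; move: (_ ^+ n) (_ ^+ n) (p0 p) => P Q.
move: (m%:R) (p.+1%:R) (p`!%:R) => M K F n1 n2 n3; field.
by rewrite n1 n2 n3.
Qed.

(** Each application of [Gamma] raises the power of rho by at most one. *)
Lemma coef_eq0 n l p : (n < l)%N -> scal_coef n l p = 0 /\ biv_coef n l p = 0.
Proof.
elim: n l p => [|n IH] l p; first by case: l => // l _; rewrite scal_coef0 mul0r.
move=> nl; rewrite scal_coefS biv_coefS !(proj1 (IH _ _ _)) ?(ltnW nl) //.
rewrite !(proj2 (IH _ _ _)) ?(ltnW nl) // !mulr0 addr0; split => //.
case: p => [|p] /=; rewrite ?(proj2 (IH _ _ _)) ?(ltnW nl) // mulr0 sub0r.
  by case: l nl => //= l nl; rewrite (proj2 (IH _ _ _)) // mulr0 oppr0.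
by case: l nl => //= l nl; rewrite (proj2 (IH _ _ _)) // mulr0 oppr0.
Qed.

(** All terms of the recursion have the same degree k in y, hence the same k!, and its two factors
    add up to at most 2 (k + m). *)
Lemma coef_bound n l p :
  `|scal_coef n l p| <= (2 * (p + 2 * l + m)%:R) ^+ n / (p + 2 * l)`!%:R /\
  `|biv_coef n l p| <= (2 * (p.+1 + 2 * l + m)%:R) ^+ n / (p.+1 + 2 * l)`!%:R.
Proof.
have fgt0 k : 0 < (k`!%:R : R) by rewrite ltr0n fact_gt0.
have m2 : 0 <= (m%:R - 2 : R) by rewrite subr_ge0 ler_nat ltnW.
elim: n l p => [|n IH] l p.
  rewrite scal_coef0 biv_coef0 !expr0 normr0; split; last by rewrite divr_ge0 // ltW.
  case: l => [|l]; last by rewrite mul0r normr0 divr_ge0 // ltW.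
  by rewrite muln0 addn0 ger0_norm // divr_ge0 // ltW.
have Mge0 k : 0 <= (2 * (k + m)%:R) ^+ n / k`!%:R :> R.
  by rewrite divr_ge0 // ?exprn_ge0 // mulr_ge0.
rewrite scal_coefS biv_coefS; split.
  have mp0 : 0 <= (m%:R - 2 + p%:R : R) by rewrite addr_ge0.
  set k := (p + 2 * l)%N; set M := (2 * (k + m)%:R) ^+ n / k`!%:R : R.
  have M0 : 0 <= M by exact: Mge0.
  have b1 : `|lag (biv_coef n l) p| <= M.
    rewrite /M /k; case: p {mp0 k M M0} => [|p] /=; last exact: (IH _ _).2.
    by rewrite normr0 Mge0.
  have b2 : `|lag ((biv_coef n)^~ p.+1) l| <= M.
    rewrite /M /k; case: l {k M M0 b1} => [|l] /=.
      by rewrite normr0 Mge0.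
    have -> : (p + 2 * l.+1 = p.+2 + 2 * l)%N by lia.
    exact: (IH _ _).2.
  rewrite exprS -mulrA -/M; apply: (le_trans (ler_normB _ _)).
  rewrite !normrM (ger0_norm mp0) normr_nat.
  apply: (@le_trans _ _ ((m%:R - 2 + p%:R) * M + p.+1%:R * M)).
    by rewrite lerD // ler_wpM2l.
  rewrite -mulrDl ler_wpM2r // /k 2!natrD natrM -natr1.
  have : 0 <= (l%:R : R) by []. by lra.
set k := (p.+1 + 2 * l)%N; set M := (2 * (k + m)%:R) ^+ n / k`!%:R : R.
have M0 : 0 <= M by exact: Mge0.
rewrite exprS -mulrA -/M; apply: (le_trans (ler_normD _ _)).
rewrite !normrM (ger0_norm m2) normr_nat.
apply: (@le_trans _ _ (p.+1%:R * M + (m%:R - 2) * M)).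
  by rewrite lerD // ler_wpM2l //; [exact: (IH _ _).1|exact: (IH _ _).2].
rewrite -mulrDl ler_wpM2r // /k 2!natrD natrM -natr1.
have : 0 <= (l%:R : R) by []. have : 0 <= (p%:R : R) by []. by lra.
Qed.

End Coefficients.

(** * Series with complex terms *)

Section ComplexSeries.
Variable R : realType.
Implicit Types (u v : nat -> R[i]) (k l : R[i]).

Lemma complexP k l : complex.Re k = complex.Re l -> complex.Im k = complex.Im l -> k = l.
Proof. by case: k l => ? ? [? ?] /= -> ->. Qed.

Definition csums u l :=
  series (fun n => complex.Re (u n)) @ \oo --> complex.Re l /\
  series (fun n => complex.Im (u n)) @ \oo --> complex.Im l.

Lemma eq_csums u v l : u =1 v -> csums u l -> csums v l.
Proof. by move=> /funext ->. Qed.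

Lemma csumsD u v k l : csums u k -> csums v l -> csums (fun n => u n + v n) (k + l).
Proof.
move=> [u1 u2] [v1 v2]; split.
  rewrite cReD; under eq_fun do rewrite cReD.
  by rewrite [series _](seriesD (fun n => complex.Re (u n))); exact: cvgD.
rewrite cImD; under eq_fun do rewrite cImD.
by rewrite [series _](seriesD (fun n => complex.Im (u n))); exact: cvgD.
Qed.

Lemma cvg_seriesZ (w : nat -> R) (a b : R) :
  series w @ \oo --> b -> series (fun n => a * w n) @ \oo --> a * b.
Proof.
move=> wb; rewrite [series _](seriesZ w a); exact: cvgZr.
Qed.

Lemma csumsZ k u l : csums u l -> csums (fun n => k * u n) (k * l).
Proof.
move=> [u1 u2]; split.
  rewrite cReM; under eq_fun do rewrite cReM.
  rewrite [series _](seriesD (fun n => complex.Re k * complex.Re (u n))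
    (fun n => - (complex.Im k * complex.Im (u n)))).
  apply: cvgD; first exact: cvg_seriesZ.
  by rewrite seriesN; apply: cvgN; exact: cvg_seriesZ.
rewrite cImM; under eq_fun do rewrite cImM.
rewrite [series _](seriesD (fun n => complex.Re k * complex.Im (u n))).
by apply: cvgD; exact: cvg_seriesZ.
Qed.

Lemma csums0 : csums (fun=> 0) 0.
Proof.
by split; apply: cvg_near_cst; apply: nearW => n; rewrite /series /= big1.
Qed.

Lemma csums_sum (I : Type) (r : seq I) (U : I -> nat -> R[i]) (L : I -> R[i]) :
  (forall i, csums (U i) (L i)) ->
  csums (fun n => \sum_(i <- r) U i n) (\sum_(i <- r) L i).
Proof.
move=> UL; elim: r => [|i r IH].
  rewrite big_nil; apply: eq_csums csums0 => n; by rewrite big_nil.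
rewrite big_cons; apply: eq_csums (csumsD (UL i) IH) => n; by rewrite big_cons.
Qed.

Definition clag u n : R[i] := if n is n'.+1 then u n' else 0.

Lemma csums_lag u l : csums u l -> csums (clag u) l.
Proof.
move=> [u1 u2]; split; rewrite -cvg_shiftS.
  rewrite (_ : [sequence _]_n = series (fun n => complex.Re (u n))) //.
  by apply/funext => n; rewrite /series /= big_nat_recl // add0r.
rewrite (_ : [sequence _]_n = series (fun n => complex.Im (u n))) //.
by apply/funext => n; rewrite /series /= big_nat_recl // add0r.
Qed.

(** Growth of exponential type: it gives convergence everywhere and passes to the formal derivative
    with the same [C]. *)
Definition entire u := exists D : R, exists C : R, 0 <= C /\ forall p,
  `|complex.Re (u p)| <= D * C ^+ p / p`!%:R /\
  `|complex.Im (u p)| <= D * C ^+ p / p`!%:R.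

Lemma cvg_exp_bound (c : nat -> R) (D C s : R) : 0 <= C ->
  (forall p, `|c p| <= D * C ^+ p / p`!%:R) -> cvgn (pseries c s).
Proof.
move=> C0 cD; have D0 : 0 <= D.
  by have := cD 0%N; rewrite expr0 mulr1 divr1; apply: le_trans.
apply: normed_cvg; rewrite /normed_series_of /=.
apply: (@series_le_cvg _ _ (fun p => D * exp_coeff (C * `|s|) p)) => //.
- by move=> p; rewrite mulr_ge0 // divr_ge0 // exprn_ge0 // mulr_ge0.
- move=> p; rewrite normrM normrX /exp_coeff /= exprMn mulrA.
  rewrite [X in _ <= X / _]mulrA [leRHS]mulrAC ler_wpM2r // ?exprn_ge0 //.
- apply/cvg_ex; exists (D * expR (C * `|s|)); apply: cvg_seriesZ.
  exact: is_cvg_series_exp_coeff.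
Qed.

Lemma entire_diffs u : entire u -> entire (fun p => p.+1%:R * u p.+1).
Proof.
move=> [D [C [C0 uD]]]; exists (D * C), C; split => // p; have [u1 u2] := uD p.+1.
have E (t : R) : `|t| <= D * C ^+ p.+1 / (p.+1)`!%:R ->
    `|p.+1%:R * t| <= D * C * C ^+ p / p`!%:R.
  move=> tD; rewrite normrM normr_nat.
  apply: (@le_trans _ _ (p.+1%:R * (D * C ^+ p.+1 / (p.+1)`!%:R))).
    by rewrite ler_wpM2l.
  rewrite le_eqVlt; apply/orP; left; apply/eqP.
  have : (p.+1%:R : R) != 0 by rewrite pnatr_eq0.
  have : (p`!%:R : R) != 0 by rewrite pnatr_eq0 -lt0n fact_gt0.
  rewrite factS natrM exprS; move: (p.+1%:R) (p`!%:R) => P Q n1 n2; field.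
  by rewrite n1 n2.
rewrite -rcn; case: (u p.+1) u1 u2 => a b /= u1 u2; simpc; split; exact: E.
Qed.

Definition pserC u (s : R) : R[i] :=
  limn (pseries (fun p => complex.Re (u p)) s) +i*
  limn (pseries (fun p => complex.Im (u p)) s).

Lemma csums_pserC u s : entire u -> csums (fun p => u p * (s ^+ p)%:C) (pserC u s).
Proof.
move=> [D [C [C0 uD]]]; split.
  rewrite (_ : (fun n => _) = (fun n => complex.Re (u n) * s ^+ n)); last first.
    by apply/funext => n; rewrite cReM /= mulr0 subr0.
  exact: (cvg_exp_bound C0 (fun p => (uD p).1)).
rewrite (_ : (fun n => _) = (fun n => complex.Im (u n) * s ^+ n)); last first.
  by apply/funext => n; rewrite cImM /= mulr0 add0r.
exact: (cvg_exp_bound C0 (fun p => (uD p).2)).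
Qed.

Lemma pserC_unique u s l : csums (fun p => u p * (s ^+ p)%:C) l -> pserC u s = l.
Proof.
move=> [l1 l2]; apply: complexP; apply: cvg_lim => //; rewrite /pseries.
  rewrite (_ : [sequence _]_n = (fun n => complex.Re (u n * (s ^+ n)%:C))) //.
  by apply/funext => n /=; rewrite cReM /= mulr0 subr0.
rewrite (_ : [sequence _]_n = (fun n => complex.Im (u n * (s ^+ n)%:C))) //.
by apply/funext => n /=; rewrite cImM /= mulr0 add0r.
Qed.

Lemma is_derive_pserC u s : entire u ->
  is_derive s (1 : R) (fun s => complex.Re (pserC u s))
     (complex.Re (pserC (fun p => p.+1%:R * u p.+1) s)) /\
  is_derive s (1 : R) (fun s => complex.Im (pserC u s))
     (complex.Im (pserC (fun p => p.+1%:R * u p.+1) s)).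
Proof.
move=> eu; have eu1 := entire_diffs eu; have eu2 := entire_diffs eu1.
have ReE (v : nat -> R[i]) : pseries_diffs (fun p => complex.Re (v p)) =
    (fun p => complex.Re (p.+1%:R * v p.+1)).
  by apply/funext => p; rewrite -rcn cReM /= mul0r subr0.
have ImE (v : nat -> R[i]) : pseries_diffs (fun p => complex.Im (v p)) =
    (fun p => complex.Im (p.+1%:R * v p.+1)).
  by apply/funext => p; rewrite -rcn cImM /= mul0r addr0.
have cR v t : entire v -> cvgn (pseries (fun p => complex.Re (v p)) t).
  by move=> [D [C [C0 vD]]]; exact: (cvg_exp_bound C0 (fun p => (vD p).1)).
have cI v t : entire v -> cvgn (pseries (fun p => complex.Im (v p)) t).
  by move=> [D [C [C0 vD]]]; exact: (cvg_exp_bound C0 (fun p => (vD p).2)).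
(* Term-by-term differentiation asks for convergence at a point of larger modulus; |s| + 1
   serves. *)
have ltK : `|s| < `| `|s| + 1| by rewrite [ltRHS]ger0_norm ?addr_ge0 // ltrDl.
split => /=.
  by rewrite -ReE; apply: (pseries_snd_diffs _ _ _ ltK); rewrite ?ReE; exact: cR.
by rewrite -ImE; apply: (pseries_snd_diffs _ _ _ ltK); rewrite ?ImE; exact: cI.
Qed.

End ComplexSeries.

(** * Iterates of the Gamma operator on the plane wave *)

Section Iterates.
Variable R : realType.

Definition minus_i : R[i] := 0 +i* (-1).

(** A crude form of modulus at most 1, enough for powers of i and stable under multiplication by i
    and -i. *)
Definition cunit (z : R[i]) := `|complex.Re z| <= 1 /\ `|complex.Im z| <= 1.

Lemma cunit_mul_i (b : bool) z : cunit z -> cunit ((if b then 0 +i* 1 else minus_i) * z).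
Proof.
rewrite /cunit cReM cImM; case: b => /=; rewrite !mul0r ?mul1r ?mulN1r ?opprK;
  by rewrite ?add0r ?addr0 ?sub0r ?normrN => -[].
Qed.

Lemma cunit_mi_exp k : cunit (minus_i ^+ k).
Proof.
elim: k => [|k IH]; first by rewrite expr0 /cunit /= normr1 normr0.
by rewrite exprS; apply: (@cunit_mul_i false).
Qed.

Lemma cunit_scale z (a B : R) : cunit z -> `|a| <= B ->
  `|complex.Re (z * a%:C)| <= B /\ `|complex.Im (z * a%:C)| <= B.
Proof.
move=> [z1 z2] aB; rewrite cReM cImM /= !mulr0 subr0 add0r !normrM.
by split; rewrite -[B]mul1r ler_pM.
Qed.

Lemma exp_coeff_le_expR (t : R) n : 0 <= t -> t ^+ n / n`!%:R <= expR t.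
Proof.
move=> t0; have := nondecreasing_cvgn_le
  (nondecreasing_series (fun k _ _ => exp_coeff_ge0 k t0)) (is_cvg_series_exp_coeff t) n.+1.
apply: le_trans; rewrite /series /= big_nat_recr //= lerDr.
by apply: sumr_ge0 => k _; exact: exp_coeff_ge0.
Qed.

(** The shape with [odd] and [n.-1./2] is the one of [cos_coeff] and [sin_coeff]. *)
Lemma ci_exp n : (0 +i* 1 : R[i]) ^+ n =
  ((~~ odd n)%:R * (-1) ^+ n./2) +i* ((odd n)%:R * (-1) ^+ n.-1./2).
Proof.
have dbl j : (0 +i* 1 : R[i]) ^+ j.*2 = ((-1) ^+ j)%:C.
  rewrite -muln2 mulnC exprM rcX; congr (_ ^+ _).
  by apply: complexP; rewrite ?cReM ?cImM /=; ring.
rewrite -{1}(odd_double_half n); case: (boolP (odd n)) => on /=.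
  rewrite add1n exprS dbl; have -> : n.-1./2 = n./2.
    by rewrite -{1}(odd_double_half n) on /= doubleK.
  by apply: complexP; rewrite ?cReM ?cImM /=; ring.
rewrite add0n dbl mul0r mul1r; by [].
Qed.

Lemma csums_cexpi (t : R) :
  csums (fun n => (0 +i* 1) ^+ n * (t ^+ n / n`!%:R)%:C) (cexpi t).
Proof.
split.
  rewrite (_ : (fun n => _) = cos_coeff t).
    by rewrite /cexpi /= unlock; exact: is_cvg_series_cos_coeff.
  by apply/funext => n; rewrite ci_exp cReM /= mulr0 subr0 mulrA.
rewrite (_ : (fun n => _) = sin_coeff t).
  by rewrite /cexpi /= unlock; exact: is_cvg_series_sin_coeff.
by apply/funext => n; rewrite ci_exp cImM /= mulr0 add0r mulrA.
Qed.

Lemma pserC_plane_wave (s : R) : pserC (fun p => minus_i ^+ p * (p`!%:R^-1)%:C) s = cexpi (- s).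
Proof.
apply: pserC_unique; apply: eq_csums (csums_cexpi (- s)) => p.
have -> : minus_i = (0 +i* 1) * (-1)%:C by apply: complexP; rewrite ?cReM ?cImM /=; ring.
by rewrite -[- s]mulN1r !(rcM, rcX, exprMn); ring.
Qed.

Variable m : nat.
Hypothesis hm : (2 < m)%N.

(* [e^{-is}] instead of [e^s]: a term of degree [k] acquires the factor
   [(-i)^k]. *)
Definition scal_cf n l p : R[i] := minus_i ^+ (p + 2 * l) * (scal_coef R m n l p)%:C.
Definition biv_cf n l p : R[i] := minus_i ^+ (p.+1 + 2 * l) * (biv_coef R m n l p)%:C.

(** By t^n <= n! e^t the numerator grows only geometrically in k. The constant depends on n, which
    is harmless for the convergence of a single iterate. *)
Lemma coef_bound_exp n k c : 
  (2 * (k + c + m)%:R) ^+ n / (k + c)`!%:R <=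
  (n`!%:R * expR (2 * (c + m)%:R)) * expR 2 ^+ k / k`!%:R :> R.
Proof.
have f0 j : 0 < (j`!%:R : R) by rewrite ltr0n fact_gt0.
have t0 : 0 <= (2 * (k + c + m)%:R : R) by rewrite mulr_ge0.
rewrite ler_pM ?exprn_ge0 ?invr_ge0 //.
  have := exp_coeff_le_expR n t0; rewrite ler_pdivrMr // => /le_trans; apply.
  rewrite mulrC -mulrA ler_wpM2l // -expRM_natl -expRD ler_expR.
  by rewrite !natrD; lra.
rewrite lef_pV2 ?posrE // ler_nat.
by elim: c {t0} => [|c IH]; rewrite ?addn0 // addnS factS (leq_trans IH) // leq_pmull.
Qed.

Lemma entire_scal_cf n l : entire (scal_cf n l).
Proof.
exists (n`!%:R * expR (2 * (2 * l + m)%:R)), (expR 2); split; first exact: expR_ge0.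
move=> p; apply: cunit_scale; first exact: cunit_mi_exp.
by apply: (le_trans (coef_bound R hm n l p).1); exact: coef_bound_exp.
Qed.

Lemma entire_biv_cf n l : entire (biv_cf n l).
Proof.
exists (n`!%:R * expR (2 * ((2 * l).+1 + m)%:R)), (expR 2); split; first exact: expR_ge0.
move=> p; apply: cunit_scale; first exact: cunit_mi_exp.
apply: (le_trans (coef_bound R hm n l p).2); rewrite addSnnS; exact: coef_bound_exp.
Qed.

Lemma pserC_biv_cfS n l s : pserC (biv_cf n.+1 l) s =
  pserC (fun p => p.+1%:R * scal_cf n l p.+1) s + (m%:R - 2) * pserC (biv_cf n l) s.
Proof.
apply: pserC_unique; apply: eq_csums (csumsD (csums_pserC s (entire_diffs (entire_scal_cf n l)))
  (csumsZ (m%:R - 2) (csums_pserC s (entire_biv_cf n l)))) => p.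
rewrite /biv_cf /scal_cf biv_coefS rcD !rcM rcB !rcn; ring.
Qed.

(** [clag] realigns s times a series with the powers of s. All terms carry the same phase, because
    they have the same degree p + 2l in y. *)
Lemma pserC_scal_cfS n l s : pserC (scal_cf n.+1 l) s =
  (m%:R - 1) * s%:C * pserC (biv_cf n l) s +
  (s ^+ 2)%:C * pserC (fun p => p.+1%:R * biv_cf n l p.+1) s -
  (if l is l'.+1 then pserC (fun p => p.+1%:R * biv_cf n l' p.+1) s else 0).
Proof.
have b := csums_pserC s (entire_biv_cf n l).
have b' k := csums_pserC s (entire_diffs (entire_biv_cf n k)).
have c0 : csums (fun p => - (if l is l'.+1 then p.+1%:R * biv_cf n l' p.+1 * (s ^+ p)%:C else 0))
   (- (if l is l'.+1 then pserC (fun p => p.+1%:R * biv_cf n l' p.+1) s else 0)).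
  rewrite -mulN1r; case: (l) => [|l'].
    by rewrite mulr0; apply: eq_csums (csums0 R) => p; rewrite oppr0.
  by apply: eq_csums (csumsZ (-1) (b' l')) => p; rewrite mulN1r.
apply: pserC_unique; apply: eq_csums (csumsD (csumsD
  (csumsZ ((m%:R - 1) * s%:C) (csums_lag b))
  (csumsZ ((s ^+ 2)%:C) (csums_lag (csums_lag (b' l))))) c0) => p.
have -> : - (if l is l'.+1 then p.+1%:R * biv_cf n l' p.+1 * (s ^+ p)%:C else 0) =
   - (minus_i ^+ (p + 2 * l) * (p.+1%:R * lag ((biv_coef R m n)^~ p.+1) l)%:C * (s ^+ p)%:C).
  case: (l) => [|l'] /=; first by rewrite mulr0 mulr0 mul0r.
  rewrite /biv_cf rcM rcn; have -> : (p.+2 + 2 * l' = p + 2 * l'.+1)%N by lia.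
  ring.
have E (t w : R) : ((m%:R - 2 + p%:R) * t - w)%:C =
    (m%:R - 2 + p%:R) * t%:C - w%:C :> R[i].
  by rewrite rcB rcM rcD rcB !rcn.
rewrite [in RHS]/scal_cf scal_coefS E [X in _ = X * _]mulrBr [RHS]mulrBl; congr (_ - _).
case: p {E} => [|[|p]] /=.
- by rewrite !(mulr0, mul0r) addr0.
- rewrite /biv_cf expr1 expr0 mulr0 addr0; ring.
- rewrite /biv_cf !rcX -!natr1 !exprS; ring.
Qed.

(** The iterate is [Fn] + B [Gn]; the sums stop at l = n by [coef_eq0], and [dFn], [dGn] are the
    derivatives in s. *)
Definition Fn n s rho : R[i] := \sum_(l < n.+1) (rho ^+ l)%:C * pserC (scal_cf n l) s.
Definition Gn n s rho : R[i] := \sum_(l < n.+1) (rho ^+ l)%:C * pserC (biv_cf n l) s.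
Definition dFn n s rho : R[i] :=
  \sum_(l < n.+1) (rho ^+ l)%:C * pserC (fun p => p.+1%:R * scal_cf n l p.+1) s.
Definition dGn n s rho : R[i] :=
  \sum_(l < n.+1) (rho ^+ l)%:C * pserC (fun p => p.+1%:R * biv_cf n l p.+1) s.

Lemma scal_cf_eq0 n l p : (n < l)%N -> scal_cf n l p = 0.
Proof. by move=> nl; rewrite /scal_cf (coef_eq0 R m p nl).1 mulr0. Qed.

Lemma biv_cf_eq0 n l p : (n < l)%N -> biv_cf n l p = 0.
Proof. by move=> nl; rewrite /biv_cf (coef_eq0 R m p nl).2 mulr0. Qed.

Lemma pserC_eq0 (u : nat -> R[i]) s : u =1 (fun=> 0) -> pserC u s = 0.
Proof.
move=> u0; apply: pserC_unique; apply: eq_csums (csums0 R) => p.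
by rewrite u0 mul0r.
Qed.

Lemma GnS n s rho : dFn n s rho + (m%:R - 2) * Gn n s rho = Gn n.+1 s rho.
Proof.
rewrite [RHS]/Gn big_ord_recr /= [X in _ = _ + _ * X]pserC_eq0 ?mulr0 ?addr0; last first.
  move=> p; rewrite /biv_cf biv_coefS (coef_eq0 R m p.+1 (ltnSn n)).1.
  by rewrite (coef_eq0 R m p (ltnSn n)).2 !mulr0 addr0 mulr0.
rewrite /dFn /Gn mulr_sumr -big_split; apply: eq_bigr => l _ /=.
rewrite pserC_biv_cfS; ring.
Qed.

Lemma FnS n s rho :
  (m%:R - 1) * s%:C * Gn n s rho + (s ^+ 2 - rho)%:C * dGn n s rho = Fn n.+1 s rho.
Proof.
rewrite /Fn; under eq_bigr do rewrite pserC_scal_cfS mulrBr.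
rewrite sumrB big_ord_recr /= [X in _ = _ + X - _](_ : _ = 0) ?addr0; last first.
  rewrite !pserC_eq0 ?mulr0 ?addr0 ?mulr0 // => p; rewrite biv_cf_eq0 ?mulr0 //.
(* The part with rho g_s starts at l = 1; without its zero term it is rho times [dGn]. *)
rewrite [X in _ = _ - X]big_ord_recl /= mulr0 add0r.
rewrite rcB [X in _ + X = _]mulrBl addrA; congr (_ - _).
  rewrite /Gn /dGn !mulr_sumr -big_split; apply: eq_bigr => l _ /=; ring.
rewrite /dGn mulr_sumr; apply: eq_bigr => l _ /=.
by rewrite exprS rcM mulrA.
Qed.

Variable x : 'rV[R]_m.
Implicit Types y z v : 'rV[R]_m.

(** Along the line through y the inner function is affine with slope [g v], so the difference
    quotient is that of [f] in direction [g v]. *)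
Lemma is_derive_comp_additive (f : R -> R) (g : 'rV[R]_m -> R) y v (df : R) :
  (forall h, g (h *: v + y) = h * g v + g y) -> is_derive (g y) (1 : R) f df ->
  is_derive y v (f \o g) (df * g v).
Proof.
move=> gl fd.
have df1 : differentiable f (g y) by apply/derivable1_diffP.
have E : (fun h : R => h^-1 *: ((f \o g) (h *: v + y) - (f \o g) y)) =
   (fun h : R => h^-1 *: (f (h *: g v + g y) - f (g y))).
  by apply/funext => h /=; rewrite gl.
have D : 'D_(g v) f (g y) = df * g v.
  rewrite deriveE // -[g v in LHS]mulr1 -[_ * 1]/(g v *: 1) linearZ /= -deriveE //.
  by rewrite derive_val mulrC.
apply: DeriveDef.
  by rewrite /derivable E; exact: diff_derivable.
by rewrite -D /derive E.
Qed.

Lemma dotp_additive h v y : dotp x (h *: v + y) = h * dotp x v + dotp x y.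
Proof.
rewrite /dotp mulr_sumr -big_split; apply: eq_bigr => j _ /=.
by rewrite !mxE; ring.
Qed.

Lemma dotp_delta k : dotp x 'e_k = x 0 k.
Proof.
rewrite /dotp (bigD1 k) //= big1 ?addr0 => [|j jk].
  by rewrite mxE !eqxx mulr1.
by rewrite mxE (negPf jk) andbF mulr0.
Qed.

Lemma is_cderive_pserC (u : nat -> R[i]) y k : entire u ->
  is_cderive (fun z => pserC u (dotp x z)) y 'e_k
    (pserC (fun p => p.+1%:R * u p.+1) (dotp x y) * (x 0 k)%:C).
Proof.
move=> eu; have [d1 d2] := is_derive_pserC (dotp x y) eu.
split; rewrite ?cReM ?cImM /= mulr0 ?subr0 ?add0r -dotp_delta.
  exact: (is_derive_comp_additive (fun h => dotp_additive h 'e_k y) d1).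
exact: (is_derive_comp_additive (fun h => dotp_additive h 'e_k y) d2).
Qed.

Lemma is_cderive_sum (I : Type) (r : seq I) (f : I -> 'rV[R]_m -> R[i]) y v (d : I -> R[i]) :
  (forall i, is_cderive (f i) y v (d i)) ->
  is_cderive (fun z => \sum_(i <- r) f i z) y v (\sum_(i <- r) d i).
Proof.
move=> fd; elim: r => [|i r IH].
  rewrite big_nil; under [X in is_cderive X]eq_fun do rewrite big_nil.
  exact: is_cderive_cst.
rewrite big_cons; under [X in is_cderive X]eq_fun do rewrite big_cons.
exact: is_cderiveD.
Qed.

Definition rho y : R := dotp x x * dotp y y.

Lemma is_cderive_rho_exp l y k :
  is_cderive (fun z => (rho z ^+ l)%:C) y 'e_k
    ((l%:R * rho y ^+ l.-1 * (2 * dotp x x))%:C * (y 0 k)%:C).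
Proof.
have coordD j : is_cderive (fun z => (z 0 j)%:C) y 'e_k (('e_k : 'rV[R]_m) 0 j)%:C.
  split; last exact: is_derive_cst.
  by apply: (@is_derive_additive _ _ (fun z => z 0 j)) => h; rewrite !mxE.
have rhoD : is_cderive (fun z => (rho z)%:C) y 'e_k ((2 * dotp x x * y 0 k)%:C).
  have -> : (fun z => (rho z)%:C) =
     (fun z => (dotp x x)%:C * \sum_j (z 0 j)%:C * (z 0 j)%:C).
    apply/funext => z; rewrite /rho rcM; congr (_ * _).
    by rewrite [dotp z z]/dotp rc_sum; apply: eq_bigr => j _; rewrite rcM.
  have := is_cderiveM (is_cderive_cst (dotp x x)%:C y 'e_k)
    (is_cderive_sum (index_enum _) (fun j => is_cderiveM (coordD j) (coordD j))).
  rewrite mul0r add0r (bigD1 k) //= big1 ?addr0 => [|j jk]; last first.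
    by rewrite !mxE (negPf jk) andbF /= mul0r mulr0 addr0.
  rewrite mxE !eqxx /= mul1r mulr1 -!rcD -rcM.
  by congr (is_cderive _ _ _ _%:C); ring.
elim: l => [|l IH].
  rewrite !mul0r; under [X in is_cderive X]eq_fun do rewrite expr0.
  exact: is_cderive_cst.
under [X in is_cderive X]eq_fun do rewrite exprS rcM.
have := is_cderiveM rhoD IH; rewrite -!rcM -rcD.
congr (is_cderive _ _ _ _%:C); case: l {IH} => [|l] /=.
  by rewrite expr0 !mul0r mulr0 addr0 !mulr1; ring.
by rewrite -natr1 exprS; ring.
Qed.

(** The coefficient [c] along y stays existential: [Gamma_bivector] accepts any value, the same for
    all k. *)
Lemma is_cderive_series N (u : nat -> nat -> R[i]) y : (forall l, entire (u l)) ->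
  exists c, forall k,
  is_cderive (fun z => \sum_(l < N) (rho z ^+ l)%:C * pserC (u l) (dotp x z)) y 'e_k
   ((\sum_(l < N) (rho y ^+ l)%:C * pserC (fun p => p.+1%:R * u l p.+1) (dotp x y)) *
      (x 0 k)%:C + c * (y 0 k)%:C).
Proof.
move=> eu; exists (\sum_(l < N) (l%:R * rho y ^+ l.-1 * (2 * dotp x x))%:C *
   pserC (u l) (dotp x y)) => k.
have := is_cderive_sum (index_enum _) (fun l : 'I_N =>
  is_cderiveM (is_cderive_rho_exp l y k) (is_cderive_pserC y k (eu l))).
congr (is_cderive _ _ _ _).
rewrite !mulr_suml -big_split; apply: eq_bigr => l _ /=; ring.
Qed.

Lemma iter_Gamma n : iter n (@Gamma R m) (plane_wave x) =
  fun y => cl_scal m (Fn n (dotp x y) (rho y)) + Gn n (dotp x y) (rho y) *: wedge x y.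
Proof.
elim: n => [|n IH] /=.
  apply/funext => y; rewrite /plane_wave /Fn /Gn !big_ord1 expr0 !mul1r.
  rewrite [X in _ + X *: _]pserC_eq0 => [|p]; last by rewrite /biv_cf biv_coef0 mulr0.
  rewrite scale0r addr0; congr cl_scal; rewrite -pserC_plane_wave.
  congr pserC; apply/funext => p.
  by rewrite /scal_cf scal_coef0 muln0 addn0 eqxx div1r.
rewrite IH; apply/funext => y.
have [f2 fD] := is_cderive_series n.+1 y (entire_scal_cf n).
have [g2 gD] := is_cderive_series n.+1 y (entire_biv_cf n).
by rewrite (Gamma_bivector fD gD) -FnS -GnS.
Qed.

End Iterates.

(** * Summation of the exponential series *)

Section Tannery.
Variable R : realType.

Lemma series_norm_le (a M : nat -> R) (A B : R) : (forall k, `|a k| <= M k) ->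
  series a @ \oo --> A -> series M @ \oo --> B ->
  forall K, `|A - series a K| <= B - series M K.
Proof.
move=> aM aA MB K.
have c1 : `|series a N - series a K| @[N --> \oo] --> `|A - series a K|.
  by apply: cvg_norm; apply: cvgB => //; exact: cvg_cst.
have c2 : series M N - series M K @[N --> \oo] --> B - series M K.
  by apply: cvgB => //; exact: cvg_cst.
apply: (ler_cvg_to c1 c2); near=> N.
have KN : (K <= N)%N by near: N; exact: nbhs_infty_ge.
rewrite !sub_series_geq //; apply: (le_trans (ler_norm_sum _ _ _)).
by apply: ler_sum => k _; exact: aM.
Unshelve. all: by end_near. Qed.

Lemma tannery (u : nat -> nat -> R) (v M y : nat -> R) (z B : R) :
  (forall n k, `|u n k| <= M k) -> series M @ \oo --> B ->
  (forall k, u n k @[n --> \oo] --> v k) ->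
  (forall n, series (u n) @ \oo --> y n) -> series v @ \oo --> z ->
  y @ \oo --> z.
Proof.
move=> uM MB uv uy vz.
have vM k : `|v k| <= M k.
  by apply: (cvgr_to_le (cvg_norm (uv k))); apply: nearW => n; exact: uM.
apply/cvgrPdist_lt => e e0; have e3 : 0 < e / 3 by rewrite divr_gt0.
have [K _ KB] : \forall K \near \oo, `|B - series M K| < e / 3.
  by move/cvgrPdist_lt : MB; exact.
have {KB} := KB K (leqnn K) => KB.
have fin : series (u n) K @[n --> \oo] --> series v K.
  rewrite /series /=; elim: (K) => [|K' IH].
    by rewrite big_nil; under eq_fun do rewrite big_nil; exact: cvg_cst.
  by rewrite big_nat_recr //=; under eq_fun do rewrite big_nat_recr //=; exact: cvgD.
move/cvgrPdist_lt : fin => /(_ _ e3); apply: filterS => n nK.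
have h1 := series_norm_le vM vz MB K.
have h2 := series_norm_le (uM n) (uy n) MB K.
have h3 := ler_norm (B - series M K).
have -> : z - y n = (z - series v K) + (series v K - series (u n) K) -
   (y n - series (u n) K) by ring.
apply: (le_lt_trans (ler_normB _ _)).
have := ler_normD (z - series v K) (series v K - series (u n) K).
move: h1 h2 h3 nK KB; set a := `|z - _|; set b := `|y n - _|; set c := `|_ - series (u n) K|.
set d := `|B - _|; set f := B - _; set g := `|_ + _|.
move=> *; lra.
Unshelve. all: by end_near. Qed.

End Tannery.

(** * Coefficients of the exponential of the Gamma operator *)

Section LimitCoefficients.
Variable (R : realType) (m : nat).
Hypothesis hm : (2 < m)%N.

Local Notation ci := (0 +i* 1 : R[i]).

Lemma cexpiD (s t : R) : cexpi (s + t) = cexpi s * cexpi t.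
Proof. by rewrite /cexpi cosD sinD; apply: complexP; rewrite ?cReM ?cImM /=; ring. Qed.

Lemma cexpiMn (t : R) n : cexpi (n%:R * t) = cexpi t ^+ n.
Proof.
elim: n => [|n IH]; first by rewrite mul0r expr0 /cexpi cos0 sin0.
by rewrite -natr1 mulrDl mul1r cexpiD IH exprSr.
Qed.

Lemma cexpi_pihalf : cexpi (pi / 2 : R) = ci.
Proof. by rewrite /cexpi cos_pihalf sin_pihalf. Qed.

Lemma cexpi_Npihalf : cexpi (- (pi / 2) : R) = minus_i R.
Proof. by rewrite /cexpi cosN sinN cos_pihalf sin_pihalf. Qed.

(** The Gegenbauer index lambda = (m-2)/2; the gap between the eigenvalues at l = 0 is 2 (lambda +
    p). *)
Definition half_index : R := m%:R / 2 - 1.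

(** 2^l times the Pochhammer symbol (c/2)_l. *)
Definition prodc (l : nat) (c : R) := \prod_(i < l) (c + 2 * i%:R).
(* [Xc] is the contribution of [J_1] and of the term [e^s / 2], [Yc] that of
   [J_0] with the exponent [c - 1] of [u]. *)
Definition Xc l c : R := (-1) ^+ l / (2 ^+ l.+1 * l`!%:R * prodc l (c + 1)).
Definition Yc l c : R := (-1) ^+ l / (2 ^+ l * l`!%:R * prodc l.+1 c).

Lemma prodc_gt0 l c : 0 < c -> 0 < prodc l c.
Proof. by move=> c0; apply: prodr_gt0 => i _; rewrite ltr_pwDl // mulr_ge0. Qed.

Lemma prodcSr l c : prodc l.+1 c = prodc l c * (c + 2 * l%:R).
Proof. by rewrite /prodc big_ord_recr. Qed.

Lemma prodcSl l c : prodc l.+1 c = c * prodc l (c + 2).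
Proof.
rewrite /prodc big_ord_recl mulr0 addr0; congr (_ * _); apply: eq_bigr => i _.
by rewrite /= /bump /= add1n -natr1; ring.
Qed.

Lemma prodc_shift l c : 0 < c -> prodc l (c + 2) = prodc l c * (c + 2 * l%:R) / c.
Proof.
move=> c0; rewrite -prodcSr prodcSl mulrC mulKf //; exact: lt0r_neq0.
Qed.

(** For c = lambda + p, the factor 4 (l+1)(l+1+c) is the factor 2 (l+1)(2l+m+2p) of [coef_laplace].
    The minus sign is the Laplace eigenvalue of e^{-is} as against e^s. *)
Lemma Xc_rec l c : 0 < c ->
  Xc l (c + 2) + 4 * l.+1%:R * (l%:R + 1 + c) * Xc l.+1 c = - Xc l c.
Proof.
move=> c0; have c1 : 0 < c + 1 by rewrite addr_gt0.
rewrite /Xc prodcSr (_ : c + 2 + 1 = c + 1 + 2); last by ring.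
rewrite prodc_shift // factS natrM !exprS (_ : l.+1%:R = l%:R + 1); last by rewrite natr1.
have := lt0r_neq0 (prodc_gt0 l c1).
have : c + 1 + 2 * l%:R != 0 by rewrite lt0r_neq0 // ltr_pwDl // mulr_ge0.
have : (l`!%:R : R) != 0 by rewrite pnatr_eq0 -lt0n fact_gt0.
have : (l%:R + 1 : R) != 0 by rewrite natr1 pnatr_eq0.
have : (2 ^+ l : R) != 0 by rewrite expf_neq0.
have := lt0r_neq0 c1.
move: (prodc l (c + 1)) (l`!%:R) (2 ^+ l) ((-1) ^+ l) => P F T S.
move: (l%:R) => L n1 n2 n3 n4 n5 n6; field.
by rewrite n1 n2 n3 n4 n5 n6.
Qed.

Lemma Yc_rec l c : 0 < c ->
  Yc l (c + 2) + 4 * l.+1%:R * (l%:R + 1 + c) * Yc l.+1 c = - Yc l c.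
Proof.
move=> c0.
have p2 : 0 < c + 2 * l.+1%:R by rewrite ltr_pwDl // mulr_ge0.
rewrite /Yc (prodcSr l.+1 c) prodc_shift // factS natrM !exprS.
have := lt0r_neq0 (prodc_gt0 l.+1 c0); have := lt0r_neq0 p2; have := lt0r_neq0 c0.
have : (l`!%:R : R) != 0 by rewrite pnatr_eq0 -lt0n fact_gt0.
have : (l.+1%:R : R) != 0 by rewrite pnatr_eq0.
have : (2 ^+ l : R) != 0 by rewrite expf_neq0.
rewrite natr1; move: (prodc l.+1 c) (l`!%:R) (2 ^+ l) ((-1) ^+ l) => P F T S.
move: (l.+1%:R) => L n1 n2 n3 n4 n5 n6; field.
by rewrite n1 n2 n3 n4 n5 n6.
Qed.

(** Coefficient of s^p rho^l in the half of the kernel with e^{sg s u}; [half_index / 2] is (m-2)/4,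
    and [- sg] reproduces the opposite signs of that term in the two halves. *)
Definition branch_scal (sg : R) l p : R :=
  sg ^+ p / p`!%:R * (Xc l (half_index + p%:R) - sg * (half_index / 2) * Yc l (half_index + p%:R)).
Definition branch_biv (sg : R) l p : R := sg ^+ p / p`!%:R * (Yc l (half_index + p.+1%:R) / 2).

Lemma lam_gt0 : 0 < half_index.
Proof. by rewrite /half_index subr_gt0 ltr_pdivlMr // mul1r ltr_nat. Qed.

Lemma branch_scal_rec sg l p : sg ^+ 2 = 1 ->
  p.+2%:R * p.+1%:R * branch_scal sg l p.+2 +
    2 * l.+1%:R * (2 * l%:R + m%:R + 2 * p%:R) * branch_scal sg l.+1 p = - branch_scal sg l p.
Proof.
move=> sg2; have c0 : 0 < half_index + p%:R by rewrite ltr_pwDl // lam_gt0.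
have := Xc_rec l c0; have := Yc_rec l c0.
rewrite /branch_scal (_ : half_index + p.+2%:R = half_index + p%:R + 2); last by rewrite -!natr1; ring.
rewrite (_ : m%:R = 2 * half_index + 2); last by rewrite /half_index; field.
have p1 : (p.+1%:R : R) != 0 by rewrite pnatr_eq0.
have p2 : (p.+2%:R : R) != 0 by rewrite pnatr_eq0.
have f0 : (p`!%:R : R) != 0 by rewrite pnatr_eq0 -lt0n fact_gt0.
rewrite (_ : sg ^+ p.+2 = sg ^+ p); last by rewrite -addn2 exprD sg2 mulr1.
rewrite !factS !natrM.
have -> (t : R) : p.+2%:R * p.+1%:R * (sg ^+ p / (p.+2%:R * (p.+1%:R * p`!%:R)) * t)
   = sg ^+ p / p`!%:R * t.
  move: p1 p2 f0; move: (p.+2%:R) (p.+1%:R) (p`!%:R) => P2 P1 F n1 n2 n3.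
  by field; rewrite n1 n2 n3.
set k := sg ^+ p / _; set c := half_index + p%:R.
have -> : 2 * half_index + 2 = 2 * (c - p%:R) + 2 by rewrite /c; ring.
move: (Xc l (c + 2)) (Xc l.+1 c) (Xc l c) (Yc l (c + 2)) (Yc l.+1 c) (Yc l c).
move=> X1 X2 X3 Y1 Y2 Y3 EY EX.
move/(congr1 -%R): EY; move/(congr1 -%R): EX; rewrite !opprK => <- <-; ring.
Qed.

Lemma branch_biv_rec sg l p : sg ^+ 2 = 1 ->
  p.+2%:R * p.+1%:R * branch_biv sg l p.+2 +
    2 * l.+1%:R * (2 * l%:R + 2 + m%:R + 2 * p%:R) * branch_biv sg l.+1 p = - branch_biv sg l p.
Proof.
move=> sg2; have c0 : 0 < half_index + p.+1%:R by rewrite ltr_pwDl // lam_gt0.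
have := Yc_rec l c0.
rewrite /branch_biv (_ : half_index + p.+3%:R = half_index + p.+1%:R + 2); last by rewrite -!natr1; ring.
rewrite (_ : m%:R = 2 * half_index + 2); last by rewrite /half_index; field.
have p1 : (p.+1%:R : R) != 0 by rewrite pnatr_eq0.
have p2 : (p.+2%:R : R) != 0 by rewrite pnatr_eq0.
have f0 : (p`!%:R : R) != 0 by rewrite pnatr_eq0 -lt0n fact_gt0.
rewrite (_ : sg ^+ p.+2 = sg ^+ p); last by rewrite -addn2 exprD sg2 mulr1.
rewrite !factS !natrM.
have -> (t : R) : p.+2%:R * p.+1%:R * (sg ^+ p / (p.+2%:R * (p.+1%:R * p`!%:R)) * t)
   = sg ^+ p / p`!%:R * t.
  move: p1 p2 f0; move: (p.+2%:R) (p.+1%:R) (p`!%:R) => P2 P1 F n1 n2 n3.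
  by field; rewrite n1 n2 n3.
set k := sg ^+ p / _; set c := half_index + p.+1%:R.
have -> : 2 * half_index + 2 = 2 * (c - (p%:R + 1)) + 2 by rewrite /c natr1; ring.
move: (Yc l (c + 2)) (Yc l.+1 c) (Yc l c).
move=> Y1 Y2 Y3 EY.
move/(congr1 -%R): EY; rewrite !opprK => <-; by field.
Qed.

Definition exp_weight j : R[i] := ci ^+ j * ((pi / 2) ^+ j / j`!%:R)%:C.
Definition kernel_scal l p : R[i] := (branch_scal (-1) l p)%:C - cexpi (m%:R * pi / 2) * (branch_scal 1 l p)%:C.
Definition kernel_biv l p : R[i] := (branch_biv (-1) l p)%:C - cexpi (m%:R * pi / 2) * (branch_biv 1 l p)%:C.

Lemma csums_exp_weight (mu : R) : csums (fun j => exp_weight j * (mu ^+ j)%:C) (cexpi (mu * (pi / 2))).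
Proof.
apply: eq_csums (csums_cexpi (mu * (pi / 2))) => j.
by rewrite /exp_weight exprMn !rcM; ring.
Qed.

(** The shift by -2 is a half turn: it produces the minus sign in front of the second half of the
    kernel. *)
Lemma cexpi_lam k : cexpi ((m%:R - 2 + k%:R) * (pi / 2) : R) =
  - (cexpi (m%:R * pi / 2) * ci ^+ k).
Proof.
have -> : (m%:R - 2 + k%:R) * (pi / 2) = m%:R * pi / 2 + k%:R * (pi / 2) - pi :> R.
  by field.
rewrite !cexpiD cexpiMn cexpi_pihalf.
have -> : cexpi (- pi) = - 1 :> R[i].
  by rewrite /cexpi cosN sinN cospi sinpi oppr0; apply: complexP; rewrite /= ?oppr0.
by rewrite mulrN1.
Qed.

Lemma cexpi_Nnat k : cexpi (- k%:R * (pi / 2) : R) = minus_i R ^+ k.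
Proof. by rewrite mulNr -mulrN cexpiMn cexpi_Npihalf. Qed.

Lemma mi_ci k : minus_i R ^+ k * ci ^+ k = 1.
Proof.
rewrite -exprMn (_ : minus_i R * ci = 1) ?expr1n //.
by apply: complexP; rewrite ?cReM ?cImM /=; ring.
Qed.

Lemma mi_mi k : minus_i R ^+ k * minus_i R ^+ k = ((-1) ^+ k)%:C.
Proof.
rewrite -exprMn rcX; congr (_ ^+ _).
by apply: complexP; rewrite ?cReM ?cImM /=; ring.
Qed.

Lemma lam_m : m%:R - 2 = 2 * half_index.
Proof. by rewrite /half_index; field. Qed.

Lemma Xc0 c : Xc 0 c = 1 / 2.
Proof. by rewrite /Xc /prodc big_ord0 expr0 expr1 fact0 !mulr1. Qed.

Lemma Yc0 c : Yc 0 c = c^-1.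
Proof. by rewrite /Yc /prodc big_ord1 /= !expr0 fact0 mulr0 addr0 !mul1r. Qed.

Lemma lam_nz k : half_index + k%:R != 0.
Proof. by rewrite lt0r_neq0 // ltr_pwDl // lam_gt0. Qed.

(** An eigenvalue mu sums to e^{i mu pi/2}. The phase (-i)^p doubles to (-1)^p for mu = -p and
    cancels i^p for mu = p + m - 2. *)
Lemma csums_scal_cf0 p : csums (fun j => exp_weight j * scal_cf R m j 0 p) (kernel_scal 0 p).
Proof.
have f0 : (p`!%:R : R) != 0 by rewrite pnatr_eq0 -lt0n fact_gt0.
have nz := lam_nz p.
set N := (m%:R - 2 + 2 * p%:R) * p`!%:R : R.
have := csumsD (csumsZ (minus_i R ^+ p * ((m%:R - 2 + p%:R) / N)%:C) (csums_exp_weight (- p%:R)))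
  (csumsZ (minus_i R ^+ p * (p%:R / N)%:C) (csums_exp_weight (m%:R - 2 + p%:R))).
rewrite cexpi_Nnat cexpi_lam.
have -> : minus_i R ^+ p * ((m%:R - 2 + p%:R) / N)%:C * minus_i R ^+ p +
   minus_i R ^+ p * (p%:R / N)%:C * - (cexpi (m%:R * pi / 2) * ci ^+ p) = kernel_scal 0 p.
  have -> : minus_i R ^+ p * ((m%:R - 2 + p%:R) / N)%:C * minus_i R ^+ p +
   minus_i R ^+ p * (p%:R / N)%:C * - (cexpi (m%:R * pi / 2) * ci ^+ p) =
   (minus_i R ^+ p * minus_i R ^+ p) * ((m%:R - 2 + p%:R) / N)%:C -
   (minus_i R ^+ p * ci ^+ p) * (cexpi (m%:R * pi / 2) * (p%:R / N)%:C) by ring.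
  (* What remains is (2 lambda + p)/(2 (lambda + p)) = 1/2 + lambda/(2 (lambda + p)) and p/(2
     (lambda + p)) = 1/2 - lambda/(2 (lambda + p)): the exponential terms and the J_0 terms with
     opposite signs. *)
  rewrite mi_mi mi_ci mul1r -rcM /kernel_scal; congr (_%:C - _ * _%:C);
    rewrite /branch_scal Xc0 Yc0 ?expr1n /N;
    rewrite lam_m; move: nz; move: half_index (p%:R) => L P nz; field; by rewrite f0 nz -?mulrDr ?mulf_neq0.
apply: eq_csums => j; rewrite /scal_cf (coef_l0 R hm j p).1 muln0 addn0 -/N.
rewrite !(rcM, rcD); ring.
Qed.

Lemma csums_biv_cf0 p : csums (fun j => exp_weight j * biv_cf R m j 0 p) (kernel_biv 0 p).
Proof.
have f0 : (p`!%:R : R) != 0 by rewrite pnatr_eq0 -lt0n fact_gt0.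
have nz := lam_nz p.+1.
set N := (m%:R - 2 + 2 * p.+1%:R) * p`!%:R : R.
have := csumsD (csumsZ (minus_i R ^+ p.+1 * (N^-1)%:C) (csums_exp_weight (m%:R - 2 + p.+1%:R)))
  (csumsZ (- (minus_i R ^+ p.+1 * (N^-1)%:C)) (csums_exp_weight (- p.+1%:R))).
rewrite cexpi_Nnat cexpi_lam.
have -> : minus_i R ^+ p.+1 * (N^-1)%:C * - (cexpi (m%:R * pi / 2) * ci ^+ p.+1) +
   - (minus_i R ^+ p.+1 * (N^-1)%:C) * minus_i R ^+ p.+1 = kernel_biv 0 p.
  have -> : minus_i R ^+ p.+1 * (N^-1)%:C * - (cexpi (m%:R * pi / 2) * ci ^+ p.+1) +
     - (minus_i R ^+ p.+1 * (N^-1)%:C) * minus_i R ^+ p.+1 =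
   - ((minus_i R ^+ p.+1 * minus_i R ^+ p.+1) * (N^-1)%:C) -
   (minus_i R ^+ p.+1 * ci ^+ p.+1) * (cexpi (m%:R * pi / 2) * (N^-1)%:C) by ring.
  rewrite mi_mi mi_ci mul1r -rcM -rcN /kernel_biv; congr (_%:C - _ * _%:C);
    rewrite /branch_biv Yc0 ?expr1n /N ?exprS;
    rewrite lam_m; move: nz; move: half_index (p.+1%:R) => L P nz; field; by rewrite f0 nz -?mulrDr ?mulf_neq0.
apply: eq_csums => j; rewrite /biv_cf (coef_l0 R hm j p).2 muln0 addn0 -/N.
rewrite !(rcM, rcB); ring.
Qed.

(** Summation over j is linear, so the Laplace recursion, solved for l + 1, passes to the limit,
    where [kernel_scal] obeys it as well. *)
Lemma csums_scal_cf l p : csums (fun j => exp_weight j * scal_cf R m j l p) (kernel_scal l p).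
Proof.
elim: l p => [|l IH] p.
  exact: csums_scal_cf0.
have nz : 2 * l.+1%:R * (2 * l%:R + m%:R + 2 * p%:R) != 0 :> R.
  have : (0 : R) < m%:R by rewrite ltr0n (leq_trans _ hm).
  have : (0 : R) <= l%:R by []. have : (0 : R) <= p%:R by [].
  by move=> ? ? ?; rewrite !mulf_neq0 // ?pnatr_eq0 // lt0r_neq0 //; lra.
move: nz; set N := _ * _ => nz.
have := csumsZ (- (N^-1))%:C (csumsD (IH p) (csumsZ (p.+2%:R * p.+1%:R) (IH p.+2))).
have -> : (- N^-1)%:C * (kernel_scal l p + p.+2%:R * p.+1%:R * kernel_scal l p.+2) = kernel_scal l.+1 p.
  have step sg : sg ^+ 2 = 1 ->
     branch_scal sg l.+1 p = - N^-1 * (branch_scal sg l p + p.+2%:R * p.+1%:R * branch_scal sg l p.+2).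
    move=> /(branch_scal_rec l p) E; rewrite -[branch_scal sg l p]opprK -E -/N.
    by field.
  rewrite /kernel_scal !step ?expr1n ?sqrrN ?expr1n // !(rcM, rcD, rcn); ring.
apply: eq_csums => j.
(* The terms at (l+1, p) and (l, p+2) have two degrees more than the one at (l, p); the phase (-i)^2
   = -1 accounts for the signs. *)
have -> : scal_cf R m j l.+1 p = (- N^-1)%:C * (scal_cf R m j l p + p.+2%:R * p.+1%:R * scal_cf R m j l p.+2).
  rewrite /scal_cf; have [E _] := coef_laplace R m j l p.
  have -> : scal_coef R m j l.+1 p = N^-1 * (scal_coef R m j l p - p.+2%:R * p.+1%:R * scal_coef R m j l p.+2).
    rewrite -E -/N; by field.
  rewrite (_ : p + 2 * l.+1 = p + 2 * l + 2)%N; last by lia.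
  rewrite (_ : p.+2 + 2 * l = p + 2 * l + 2)%N; last by lia.
  have mi2 : minus_i R ^+ 2 = -1 by apply: complexP; rewrite expr2 ?cReM ?cImM /=; ring.
  rewrite exprD mi2 !(rcM, rcB, rcN, rcn); ring.
ring.
Qed.

Lemma csums_biv_cf l p : csums (fun j => exp_weight j * biv_cf R m j l p) (kernel_biv l p).
Proof.
elim: l p => [|l IH] p.
  exact: csums_biv_cf0.
have nz : 2 * l.+1%:R * (2 * l%:R + 2 + m%:R + 2 * p%:R) != 0 :> R.
  have : (0 : R) < m%:R by rewrite ltr0n (leq_trans _ hm).
  have : (0 : R) <= l%:R by []. have : (0 : R) <= p%:R by [].
  by move=> ? ? ?; rewrite !mulf_neq0 // ?pnatr_eq0 // lt0r_neq0 //; lra.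
move: nz; set N := _ * _ => nz.
have := csumsZ (- (N^-1))%:C (csumsD (IH p) (csumsZ (p.+2%:R * p.+1%:R) (IH p.+2))).
have -> : (- N^-1)%:C * (kernel_biv l p + p.+2%:R * p.+1%:R * kernel_biv l p.+2) = kernel_biv l.+1 p.
  have step sg : sg ^+ 2 = 1 ->
     branch_biv sg l.+1 p = - N^-1 * (branch_biv sg l p + p.+2%:R * p.+1%:R * branch_biv sg l p.+2).
    move=> /(branch_biv_rec l p) E; rewrite -[branch_biv sg l p]opprK -E -/N.
    by field.
  rewrite /kernel_biv !step ?expr1n ?sqrrN ?expr1n // !(rcM, rcD, rcn); ring.
apply: eq_csums => j.
have -> : biv_cf R m j l.+1 p = (- N^-1)%:C * (biv_cf R m j l p + p.+2%:R * p.+1%:R * biv_cf R m j l p.+2).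
  rewrite /biv_cf; have [_ E] := coef_laplace R m j l p.
  have -> : biv_coef R m j l.+1 p = N^-1 * (biv_coef R m j l p - p.+2%:R * p.+1%:R * biv_coef R m j l p.+2).
    rewrite -E -/N; by field.
  rewrite (_ : p.+1 + 2 * l.+1 = p.+1 + 2 * l + 2)%N; last by lia.
  rewrite (_ : p.+3 + 2 * l = p.+1 + 2 * l + 2)%N; last by lia.
  have mi2 : minus_i R ^+ 2 = -1 by apply: complexP; rewrite expr2 ?cReM ?cImM /=; ring.
  rewrite exprD mi2 !(rcM, rcB, rcN, rcn); ring.
ring.
Qed.

End LimitCoefficients.

(** * Exchange of the exponential series with the expansions in s and rho *)

Section SumExchange.
Variable R : realType.

Definition ccvg (y : nat -> R[i]) (z : R[i]) :=
  (complex.Re (y n) @[n --> \oo] --> complex.Re z) /\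
  (complex.Im (y n) @[n --> \oo] --> complex.Im z).

Lemma ctannery (u : nat -> nat -> R[i]) (v : nat -> R[i]) (M : nat -> R)
    (y : nat -> R[i]) (z : R[i]) (B : R) :
  (forall n k, `|complex.Re (u n k)| <= M k /\ `|complex.Im (u n k)| <= M k) ->
  series M @ \oo --> B -> (forall k, ccvg (u^~ k) (v k)) ->
  (forall n, csums (u n) (y n)) -> csums v z -> ccvg y z.
Proof.
move=> uM MB uv uy [v1 v2]; split.
  exact: (tannery (fun n k => (uM n k).1) MB (fun k => (uv k).1) (fun n => (uy n).1) v1).
exact: (tannery (fun n k => (uM n k).2) MB (fun k => (uv k).2) (fun n => (uy n).2) v2).
Qed.

Lemma Re_sum I (r : seq I) (F : I -> R[i]) :
  complex.Re (\sum_(i <- r) F i) = \sum_(i <- r) complex.Re (F i).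
Proof. exact: (big_morph _ (@cReD R) erefl). Qed.

Lemma Im_sum I (r : seq I) (F : I -> R[i]) :
  complex.Im (\sum_(i <- r) F i) = \sum_(i <- r) complex.Im (F i).
Proof. exact: (big_morph _ (@cImD R) erefl). Qed.

Lemma csums_ccvg (u : nat -> R[i]) z :
  csums u z <-> ccvg (fun n => \sum_(0 <= j < n) u j) z.
Proof.
rewrite /csums /ccvg.
have -> : (fun n => complex.Re (\sum_(0 <= j < n) u j)) = series (fun n => complex.Re (u n)).
  by apply/funext => n; rewrite Re_sum.
have -> : (fun n => complex.Im (\sum_(0 <= j < n) u j)) = series (fun n => complex.Im (u n)).
  by apply/funext => n; rewrite Im_sum.
by [].
Qed.

Lemma series_exp_le_expR (t : R) N : 0 <= t -> series (exp_coeff t) N <= expR t.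
Proof.
move=> t0; apply: (nondecreasing_cvgn_le
  (nondecreasing_series (fun k _ _ => exp_coeff_ge0 k t0)) (is_cvg_series_exp_coeff t)).
Qed.

Lemma csums_norm_le (a : nat -> R[i]) (M : nat -> R) (A : R[i]) (B : R) :
  (forall k, `|complex.Re (a k)| <= M k /\ `|complex.Im (a k)| <= M k) ->
  csums a A -> series M @ \oo --> B ->
  `|complex.Re A| <= B /\ `|complex.Im A| <= B.
Proof.
move=> aM [a1 a2] MB.
have := series_norm_le (fun k => (aM k).1) a1 MB 0%N.
have := series_norm_le (fun k => (aM k).2) a2 MB 0%N.
by rewrite /series /= !big_nil !subr0.
Qed.

(** Common frame for the scalar and the bivector part: [e] is the degree in y of the accompanying
    factor, 0 for 1 and 1 for B. *)
Variables (m e : nat) (u : nat -> nat -> nat -> R[i]) (K : nat -> nat -> R[i]).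
Hypothesis eu : forall j l, entire (u j l).
Hypothesis u0 : forall j l p, (j < l)%N -> u j l p = 0.
Hypothesis uK : forall l p, csums (fun j => exp_weight R j * u j l p) (K l p).
Hypothesis ubound : forall j l p,
  let k := (p + 2 * l + e)%N in
  `|complex.Re (exp_weight R j * u j l p)| <= exp_coeff (pi * (k + m)%:R) j / k`!%:R /\
  `|complex.Im (exp_weight R j * u j l p)| <= exp_coeff (pi * (k + m)%:R) j / k`!%:R.

(** The bounds summed over j give e^{pi (k+m)}/k! with k = p + 2l + e; then k! >= p! l! splits this
    into a product of exponential series in |s| and |rho|. *)
Let M (s rho : R) l p : R := expR (pi * (e + m)%:R) *
  exp_coeff (expR (2 * pi) * `|rho|) l * exp_coeff (expR pi * `|s|) p.

Let k_fact l p : (p`! * l`! <= (p + 2 * l + e)`!)%N.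
Proof.
apply: (@leq_trans (p + l)`!); first by rewrite -(bin_fact (leq_addr l p)) addKn leq_pmull // bin_gt0 leq_addr.
have -> : (p + 2 * l + e = (p + l) + (l + e))%N by lia.
elim: (l + e)%N => [|c IH]; first by rewrite addn0.
by rewrite addnS factS (leq_trans IH) // leq_pmull.
Qed.

Lemma partial_bound (s rho : R) N l p :
  `|complex.Re (\sum_(0 <= j < N) exp_weight R j * u j l p * (s ^+ p)%:C * (rho ^+ l)%:C)| <= M s rho l p /\
  `|complex.Im (\sum_(0 <= j < N) exp_weight R j * u j l p * (s ^+ p)%:C * (rho ^+ l)%:C)| <= M s rho l p.
Proof.
set k := (p + 2 * l + e)%N.
have pi0 : 0 <= pi :> R by exact: pi_ge0.
have aux (a : nat -> R) : (forall j, `|a j| <= exp_coeff (pi * (k + m)%:R) j / k`!%:R) ->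
   `|\sum_(0 <= j < N) a j * s ^+ p * rho ^+ l| <= M s rho l p.
  move=> aB; rewrite -!mulr_suml !normrM !normrX.
  apply: (@le_trans _ _ (expR (pi * (k + m)%:R) / k`!%:R * `|s| ^+ p * `|rho| ^+ l)).
    rewrite 2?ler_wpM2r ?exprn_ge0 //.
    apply: (le_trans (ler_norm_sum _ _ _)).
    apply: (@le_trans _ _ (\sum_(0 <= j < N) exp_coeff (pi * (k + m)%:R) j / k`!%:R)).
      by apply: ler_sum => j _; exact: aB.
    rewrite -mulr_suml ler_wpM2r // ?invr_ge0 //.
    by apply: series_exp_le_expR; rewrite mulr_ge0.
  rewrite /M /exp_coeff /= !exprMn -!expRM_natl.
  have -> : expR (pi * (e + m)%:R) * (expR (l%:R * (2 * pi)) * `|rho| ^+ l / l`!%:R) *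
     (expR (p%:R * pi) * `|s| ^+ p / p`!%:R) =
     expR (pi * (k + m)%:R) / (p`! * l`!)%:R * `|s| ^+ p * `|rho| ^+ l.
    have -> : pi * (k + m)%:R = pi * (e + m)%:R + l%:R * (2 * pi) + p%:R * pi :> R.
      by rewrite /k (natrD _ e m) 3!natrD natrM; ring.
    rewrite !expRD natrM invfM; ring.
  rewrite 2?ler_wpM2r ?exprn_ge0 // ler_wpM2l ?expR_ge0 //.
  by rewrite lef_pV2 ?posrE ?ltr0n ?muln_gt0 ?fact_gt0 // ler_nat; exact: k_fact.
have rE (z : R[i]) (a b : R) : complex.Re (z * a%:C * b%:C) = complex.Re z * a * b.
  by rewrite !cReM /= !mulr0 !subr0.
have iE (z : R[i]) (a b : R) : complex.Im (z * a%:C * b%:C) = complex.Im z * a * b.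
  by rewrite !(cImM, cReM) /= !mulr0 !add0r.
rewrite Re_sum Im_sum; split.
  by under eq_bigr do rewrite rE; apply: aux => j; exact: (ubound j l p).1.
by under eq_bigr do rewrite iE; apply: aux => j; exact: (ubound j l p).2.
Qed.

Lemma ccvgM (y : nat -> R[i]) z k : ccvg y z -> ccvg (fun n => y n * k) (z * k).
Proof.
move=> [y1 y2]; split.
  rewrite cReM; under eq_fun do rewrite cReM.
  by apply: cvgB; apply: cvgMl.
rewrite cImM; under eq_fun do rewrite cImM.
by apply: cvgD; apply: cvgMl.
Qed.

(** The number N of terms of the exponential series is the parameter of two uses of dominated
    convergence: over p at fixed l, and over l with the sums in p of [M] as majorant. *)
Lemma csums_exchange (s rho : R) (Y : nat -> R[i]) (v : R[i]) :
  (forall l, csums (fun p => K l p * (s ^+ p)%:C * (rho ^+ l)%:C) (Y l)) ->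
  csums Y v ->
  csums (fun j => exp_weight R j * \sum_(l < j.+1) (rho ^+ l)%:C * pserC (u j l) s) v.
Proof.
move=> KY Yv; apply/csums_ccvg.
pose U N l p := \sum_(0 <= j < N) exp_weight R j * u j l p * (s ^+ p)%:C * (rho ^+ l)%:C.
pose y N l := \sum_(0 <= j < N) exp_weight R j * (rho ^+ l)%:C * pserC (u j l) s.
have Uy N l : csums (U N l) (y N l).
  apply: csums_sum => j.
  apply: eq_csums (csumsZ (exp_weight R j * (rho ^+ l)%:C) (csums_pserC s (eu j l))) => p.
  ring.
have exps t : series (exp_coeff t) @ \oo --> (expR t : R).
  exact: is_cvg_series_exp_coeff.
have Ms l : series (M s rho l) @ \oo --> expR (pi * (e + m)%:R) *
    exp_coeff (expR (2 * pi) * `|rho|) l * expR (expR pi * `|s|).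
  by apply: cvg_seriesZ.
have yY l : ccvg (y^~ l) (Y l).
  apply: (ctannery _ (Ms l) _ (fun N => Uy N l) (KY l)) => [N p|p].
    exact: partial_bound.
  have /csums_ccvg := uK l p.
  move=> /(ccvgM (s ^+ p)%:C)/(ccvgM (rho ^+ l)%:C).
  congr (ccvg _ _); apply/funext => N.
  by rewrite !mulr_suml.
have Ms2 : series (fun l => expR (pi * (e + m)%:R) *
    expR (expR pi * `|s|) * exp_coeff (expR (2 * pi) * `|rho|) l) @ \oo -->
   expR (pi * (e + m)%:R) * expR (expR pi * `|s|) * expR (expR (2 * pi) * `|rho|).
  by apply: cvg_seriesZ.
apply: (ctannery _ Ms2 yY _ Yv) => [N l|N].
  rewrite mulrAC; apply: (csums_norm_le _ (Uy N l) (Ms l)) => p.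
  exact: partial_bound.
apply: csums_sum => j.
(* The sum over l <= j is viewed as an infinite series, since [u j l] vanishes for l > j. *)
have fin : csums (fun l => (rho ^+ l)%:C * pserC (u j l) s)
    (\sum_(l < j.+1) (rho ^+ l)%:C * pserC (u j l) s).
  apply/csums_ccvg; rewrite /ccvg.
  have E : \forall n \near \oo, \sum_(0 <= l < n) (rho ^+ l)%:C * pserC (u j l) s =
     \sum_(l < j.+1) (rho ^+ l)%:C * pserC (u j l) s.
    exists j.+1 => // n /= jn; rewrite (big_cat_nat _ (n := j.+1)) //=.
    have -> : \sum_(j.+1 <= l < n) (rho ^+ l)%:C * pserC (u j l) s = 0.
      rewrite big_nat_cond big1 // => l /andP[/andP[jl _] _].
      by rewrite pserC_eq0 ?mulr0 // => p; exact: u0.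
    by rewrite addr0 big_mkord.
  split; apply: cvg_near_cst; near=> n; congr (_ _); near: n; exact: E.
by apply: eq_csums (csumsZ (exp_weight R j) fin) => l; rewrite mulrA.
Unshelve. all: by end_near. Qed.

End SumExchange.

(** * Integrals over the unit interval *)

Section Integrals.
Variable R : realType.
Local Notation mu := (@lebesgue_measure R).
Local Notation D := (`]0%R, 1%R[%classic : set R).
Implicit Types (h g : R -> R) (c : R).

(** The open interval keeps away from the endpoints, where [powR] at base 0 has conventional values;
    [int01E] returns to the closed one. *)
Definition integrable01 h := mu.-integrable D (EFin \o h).

Lemma measurableD01 : measurable D. Proof. exact: measurable_itv. Qed.

Lemma integrable01D h g : integrable01 h -> integrable01 g ->
  integrable01 (fun x => h x + g x).
Proof.
move=> ih ig; rewrite /integrable01.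
have -> : EFin \o (fun x => h x + g x) = ((EFin \o h) \+ (EFin \o g))%E by [].
apply: integrableD => //.
Qed.

Lemma eq_integrable01 h g : (forall u, D u -> h u = g u) ->
  integrable01 h -> integrable01 g.
Proof.
move=> hg; rewrite /integrable01; apply: eq_integrable => // u; rewrite inE => Du /=.
by rewrite hg.
Qed.

Lemma integrable01Z (k : R) h : integrable01 h -> integrable01 (fun x => k * h x).
Proof.
move=> ih; rewrite /integrable01.
have -> : EFin \o (fun x => k * h x) = (fun x => k%:E * (EFin \o h) x)%E by [].
exact: integrableZl.
Qed.

(** The singular weight is placed in [h], so the [a n] need only a summable uniform bound and B |h|
    dominates all partial sums. *)
Lemma Rintegral_series h (a : nat -> R -> R) (M : nat -> R) (B : R) g :
  integrable01 h -> (forall n, measurable_fun D (a n)) ->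
  (forall n x, D x -> `|a n x| <= M n) -> series M @ \oo --> B ->
  (forall x, D x -> series (a^~ x) @ \oo --> g x) ->
  integrable01 (fun x => h x * g x) /\
  series (fun n => Rintegral mu D (fun x => h x * a n x)) @ \oo -->
    Rintegral mu D (fun x => h x * g x).
Proof.
move=> ih ma aM MB ag; have mD := measurableD01.
have mh : measurable_fun D h by apply/measurable_EFinP; exact: measurable_int ih.
have M0 n : 0 <= M n.
  (* Any point of the open interval shows that [M n] is nonnegative; 1/2 is taken. *)
  apply: (le_trans (normr_ge0 (a n 2^-1))); apply: aM.
  by rewrite /= in_itv /= invr_gt0 invf_lt1 ?ltr1n ?ltr0n.
have MleB n : series M n <= B.
  have cM : cvgn (series M) by apply/cvg_ex; exists B.
  rewrite -(cvg_lim _ MB) //.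
  exact: (nondecreasing_cvgn_le (nondecreasing_series (fun k _ _ => M0 k)) cM).
have Bh0 x : 0 <= B * `|h x|.
  by rewrite mulr_ge0 //; apply: le_trans (MleB 0%N); rewrite /series /= big_nil.
have mS n : measurable_fun D (fun x => series (a^~ x) n).
  exact: (@measurable_sum _ _ _ _ _ _ (fun n => a n)).
have mg : measurable_fun D g.
  exact: (@measurable_fun_cvg _ _ _ _ (fun n x => series (a^~ x) n)).
have bound k (t : nat -> R -> R) (A : R) : measurable_fun D (t k) ->
    (forall x, D x -> `|t k x| <= A) -> integrable01 (fun x => h x * t k x).
  move=> mt tA; apply: (@le_integrable _ _ _ mu _ mD _ (fun x => A%:E * (h x)%:E)%E).
  - by apply/measurable_EFinP; exact: measurable_funM.
  - move=> x Dx; rewrite /= lee_fin !normrM mulrC ler_wpM2r //.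
    by apply: (le_trans (tA x Dx)); exact: ler_norm.
  - exact: integrableZl.
have iha n : integrable01 (fun x => h x * a n x) := bound n a (M n) (ma n) (aM n).
have SE n : Rintegral mu D (fun x => h x * series (a^~ x) n) =
    series (fun n => Rintegral mu D (fun x => h x * a n x)) n /\
    integrable01 (fun x => h x * series (a^~ x) n).
  rewrite /series /=; elim: n => [|n [IH1 IH2]].
    rewrite big_nil; have -> : (fun x => h x * \sum_(0 <= k < 0) a k x) = cst 0.
      by apply/funext => x; rewrite big_nil mulr0.
    split; first by rewrite Rintegral_cst // mul0r.
    exact: integrable0.
  have -> : (fun x => h x * \sum_(0 <= k < n.+1) a k x) =
     (fun x => h x * (\sum_(0 <= k < n) a k x) + h x * a n x).
    by apply/funext => x; rewrite big_nat_recr //= mulrDr.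
  rewrite big_nat_recr //= -IH1; split; first by rewrite RintegralD //; exact: iha.
  exact: (integrable01D IH2 (iha n)).
have ihB : mu.-integrable D (EFin \o (fun x => B * `|h x|)).
  apply: (@le_integrable _ _ _ mu _ mD _ (fun x => B%:E * (h x)%:E)%E).
  - apply/measurable_EFinP; apply: measurable_funM => //.
    exact: measurableT_comp.
  - by move=> x Dx; rewrite /= lee_fin !normrM normr_id.
  - exact: integrableZl.
pose f_ n := EFin \o (fun x => h x * series (a^~ x) n).
pose f := EFin \o (fun x => h x * g x); pose b := EFin \o (fun x => B * `|h x|).
have mf_ n : measurable_fun D (f_ n) by apply/measurable_EFinP; exact: measurable_funM.
have mf : measurable_fun D f by apply/measurable_EFinP; exact: measurable_funM.
have f_f : {ae mu, forall x, D x -> f_ ^~ x @ \oo --> f x}.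
  apply: aeW => x Dx; apply: cvg_EFin; first exact: nearW.
  by apply: cvgMr; exact: ag.
have f_b : {ae mu, forall x n, D x -> (`|f_ n x| <= b x)%E}.
  apply: aeW => x n Dx; rewrite /= lee_fin normrM mulrC ler_wpM2r //.
  apply: (le_trans _ (MleB n)); apply: (le_trans (ler_norm_sum _ _ _)).
  by apply: ler_sum => k _; exact: aM.
have [||i1 _ c1] := @dominated_convergence _ _ R mu D mD f_ f b mf_ mf _ ihB _.
- exact: f_f.
- exact: f_b.
split; first exact: i1.
have -> : series (fun n => Rintegral mu D (fun x => h x * a n x)) =
    (fun n => fine (\int[mu]_(x in D) f_ n x)%E).
  by apply/funext => n; rewrite -(SE n).1.
apply: (@fine_cvg _ _ _ _ (fun n => \int[mu]_(x in D) f_ n x)%E).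
rewrite /Rintegral fineK; first exact: c1.
by apply: integrable_fin_num => //; exact: i1.
Qed.

Lemma continuous_powR c x : 0 < x -> {for x, continuous (fun u : R => powR u c)}.
Proof.
move=> x0; apply/differentiable_continuous/derivable1_diffP.
by apply: derivable_powR; rewrite in_itv /= x0.
Qed.

Lemma int_powR_ge (a c : R) : 0 < a < 1 -> c != 0 ->
  (\int[mu]_(u in `[a, 1%R]) (powR u (c - 1)%R)%:E = ((1 - powR a c) / c)%:E)%E.
Proof.
move=> /andP[a0 a1] c0.
rewrite (@continuous_FTC2 _ _ (fun u => powR u c / c)) //.
- by rewrite powR1 -EFinB -mulrBl.
- apply: continuous_in_subspaceT => x; rewrite inE /= in_itv /= => /andP[ax _].
  by apply: continuous_powR; exact: lt_le_trans ax.
- split.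
  + move=> x; rewrite in_itv /= => /andP[ax _]; apply: derivableM => //.
    by apply: derivable_powR; rewrite in_itv /= (lt_trans a0 ax).
  + apply: cvg_at_right_filter; apply: cvgMl; exact: continuous_powR.
  + apply: cvg_at_left_filter; apply: cvgMl; exact: continuous_powR.
- move=> x; rewrite in_itv /= => /andP[ax _]; have x0 := lt_trans a0 ax.
  have xI : x \in `]0, +oo[ by rewrite in_itv /= x0.
  rewrite derive1E deriveM //; last exact: derivable_powR.
  rewrite derive_cst scaler0 add0r -derive1E powR_derive1 // /GRing.scale /=.
  by field.
Qed.

Lemma int_powR c : 0 < c ->
  (\int[mu]_(u in D) (powR u (c - 1)%R)%:E = (c^-1)%:E)%E.
Proof.
move=> c0; have cn0 := lt0r_neq0 c0.
rewrite integral_itv_bndo_bndc; last first.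
  apply/measurable_EFinP; apply: measurable_funTS; exact: measurable_powR.
(* Exhaustion of ]0, 1] for monotone convergence; [n.+2] keeps the left end below 1, as
   [int_powR_ge] demands. *)
pose F n := `[(n.+2%:R : R)^-1, 1]%classic.
have -> : `]0%R, 1%R]%classic = \bigcup_n F n.
  apply/seteqP; split => x /=; rewrite in_itv /=.
    move=> /andP[x0 x1]; exists (Num.truncn x^-1) => //.
    rewrite /F /= in_itv /= x1 andbT invf_ple ?posrE //.
    rewrite ltW // (lt_le_trans (truncnS_gt _)) // ler_nat //.
  move=> [n _]; rewrite /F /= in_itv /= => /andP[nx ->]; rewrite andbT.
  by apply: lt_le_trans nx; rewrite invr_gt0.
have c1 : ((\int[mu]_(u in F n) (powR u (c - 1)%R)%:E)%E @[n --> \oo] -->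
    (\int[mu]_(u in \bigcup_n F n) (powR u (c - 1)%R)%:E)%E).
  apply: ge0_nondecreasing_set_cvg_integral => //.
  - move=> n k nk; apply/subsetPset => x; rewrite /F /= !in_itv /= => /andP[nx ->].
    rewrite andbT; apply: le_trans nx; rewrite lef_pV2 ?posrE // ler_nat //.
  - by move=> n; exact: measurable_itv.
  - by move=> n; apply/measurable_EFinP; apply: measurable_funTS; exact: measurable_powR.
  - by move=> n x _; rewrite lee_fin powR_ge0.
have c2 : ((\int[mu]_(u in F n) (powR u (c - 1)%R)%:E)%E @[n --> \oo] --> (c^-1)%:E).
  have -> : (fun n => (\int[mu]_(u in F n) (powR u (c - 1)%R)%:E)%E) =
     (fun n => ((1 - powR (n.+2%:R^-1) c) / c)%:E).
    apply/funext => n; rewrite int_powR_ge // invr_gt0 ltr0n /=.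
    by rewrite invf_lt1 ?ltr0n // ltr1n.
  have p0 : powR (n.+2%:R^-1) c @[n --> \oo] --> (0 : R).
    apply: (proj1 (cvg_at_rightP _ _ _) (powR_cvg0 c0) (fun n => n.+2%:R^-1)); split.
      by move=> n; rewrite invr_gt0.
    have := @cvg_harmonic R; rewrite -cvg_shiftS; exact.
  have c3 : (1 - powR (n.+2%:R^-1) c) / c @[n --> \oo] --> c^-1.
    have c4 : 1 - powR (n.+2%:R^-1) c @[n --> \oo] --> (1 - 0 : R).
      by apply: cvgB => //; exact: cvg_cst.
    by have := cvgMl (b := c^-1) c4; rewrite subr0 mul1r; exact.
  by apply: cvg_EFin; [exact: nearW|exact: c3].
exact: cvg_unique c1 c2.
Qed.

Lemma integrable_powR c : 0 < c -> integrable01 (fun u => powR u (c - 1)).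
Proof.
move=> c0; apply/integrableP; split.
  by apply/measurable_EFinP; apply: measurable_funTS; exact: measurable_powR.
under eq_integral do rewrite /= ger0_norm ?powR_ge0 //.
by rewrite int_powR // ltry.
Qed.

Lemma powR_shift (u a : R) n : 0 < u -> powR u (a + n%:R - 1) = powR u (a - 1) * u ^+ n.
Proof.
move=> u0; rewrite -powR_mulrn ?ltW // -powRD ?(gt_eqF u0) ?implybT //.
by congr powR; ring.
Qed.

(** Half the beta function B(c/2, l+1). Induction rests on (1-u^2)^(l+1) = (1-u^2)^l - u^2
    (1-u^2)^l; the factor u^2 raises c by 2, so c has to vary. *)
Lemma beta_int c l : 0 < c ->
  integrable01 (fun u => powR u (c - 1) * (1 - u ^+ 2) ^+ l) /\
  Rintegral mu D (fun u => powR u (c - 1) * (1 - u ^+ 2) ^+ l) =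
    2 ^+ l * l`!%:R / prodc l.+1 c.
Proof.
have mD := measurableD01.
elim: l c => [|l IH] c c0.
  have -> : (fun u : R => powR u (c - 1) * (1 - u ^+ 2) ^+ 0) =
     (fun u => powR u (c - 1)).
    by apply/funext => u; rewrite expr0 mulr1.
  split; first exact: integrable_powR.
  rewrite /Rintegral int_powR //= /prodc big_ord1 expr0 fact0 /= mulr0 addr0.
  by rewrite !mul1r.
have c2 : 0 < c + 2 by rewrite addr_gt0.
have [i1 e1] := IH c c0; have [i2 e2] := IH (c + 2) c2.
have E u : D u -> powR u (c - 1) * (1 - u ^+ 2) ^+ l.+1 =
   powR u (c - 1) * (1 - u ^+ 2) ^+ l + -1 * (powR u (c + 2 - 1) * (1 - u ^+ 2) ^+ l).
  rewrite /= in_itv /= => /andP[u0 _].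
  rewrite (powR_shift c 2 u0) exprS; ring.
have i3 := integrable01D i1 (integrable01Z (-1) i2).
split.
  by apply: eq_integrable01 i3 => u Du; rewrite E.
rewrite (@eq_Rintegral _ _ _ mu D (fun u => powR u (c - 1) * (1 - u ^+ 2) ^+ l +
  -1 * (powR u (c + 2 - 1) * (1 - u ^+ 2) ^+ l))); last first.
  by move=> u; rewrite inE => Du; exact: E.
rewrite RintegralD //; last exact: integrable01Z.
rewrite RintegralZl // e1 e2 (prodcSr l.+1 c) prodc_shift // factS natrM exprS.
have := lt0r_neq0 (prodc_gt0 l.+1 c0); have := lt0r_neq0 c0.
have : c + 2 * l.+1%:R != 0 by rewrite lt0r_neq0 // ltr_pwDl // mulr_ge0.
move: (prodc l.+1 c) (l`!%:R) (2 ^+ l) (l.+1%:R) => P F T L n1 n2 n3.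
by field; rewrite n1 n2 n3.
Qed.

Lemma exp_beta_int c l (tau : R) : 0 < c ->
  integrable01 (fun u => powR u (c - 1) * (1 - u ^+ 2) ^+ l * expR (tau * u)) /\
  series (fun p => tau ^+ p / p`!%:R * (2 ^+ l * l`!%:R / prodc l.+1 (c + p%:R))) @ \oo -->
    Rintegral mu D (fun u => powR u (c - 1) * (1 - u ^+ 2) ^+ l * expR (tau * u)).
Proof.
move=> c0; have mD := measurableD01.
have [||i1 c1] := @Rintegral_series _ (fun p u => exp_coeff (tau * u) p)
  (exp_coeff `|tau|) (expR `|tau|) (fun u => expR (tau * u)) (beta_int l c0).1
  _ _ (is_cvg_series_exp_coeff _) (fun u _ => is_cvg_series_exp_coeff _).
- move=> p; apply: measurable_funM => //; apply: measurable_funX.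
  exact: measurable_funM.
- move=> p u; rewrite /= in_itv /= => /andP[u0 u1].
  rewrite /exp_coeff /= normrM normrX normrM (gtr0_norm u0) normfV normr_nat.
  by rewrite ler_wpM2r // exprMn ler_piMr ?exprn_ge0 // exprn_ile1 ?ltW.
split => //.
have <- : (fun p => Rintegral mu D (fun u => powR u (c - 1) * (1 - u ^+ 2) ^+ l *
      exp_coeff (tau * u) p)) =
   (fun p => tau ^+ p / p`!%:R * (2 ^+ l * l`!%:R / prodc l.+1 (c + p%:R))).
  apply/funext => p; have cp : 0 < c + p%:R by rewrite ltr_pwDl.
  have [i2 <-] := beta_int l cp.
  rewrite -RintegralZl //; apply: eq_Rintegral => u; rewrite inE /= in_itv /= => /andP[u0 _].
  rewrite powR_shift // /exp_coeff /= exprMn; ring.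
exact: c1.
Qed.

Lemma bessel_beta_int c (tau : R) (gam M : nat -> R) (B : R) g : 0 < c ->
  (forall l, `|gam l| <= M l) -> series M @ \oo --> B ->
  (forall u, D u -> series (fun l => gam l * (1 - u ^+ 2) ^+ l) @ \oo --> g u) ->
  integrable01 (fun u => g u * powR u (c - 1) * expR (tau * u)) /\
  series (fun l => gam l *
     Rintegral mu D (fun u => powR u (c - 1) * (1 - u ^+ 2) ^+ l * expR (tau * u))) @ \oo -->
  Rintegral mu D (fun u => g u * powR u (c - 1) * expR (tau * u)).
Proof.
move=> c0 gM MB gg; have mD := measurableD01.
(* The case l = 0 provides the integrable weight u^{c-1} e^{tau u}. *)
have [i0 _] := exp_beta_int 0 tau c0.
have [||i1 c1] := @Rintegral_series _ (fun l u => gam l * (1 - u ^+ 2) ^+ l) M B g i0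
  _ _ MB gg.
- move=> l; apply: measurable_funM => //; apply: measurable_funX.
  by apply: measurable_funB => //; exact: measurable_funX.
- move=> l u; rewrite /= in_itv /= => /andP[u0 u1].
  have w0 : 0 <= 1 - u ^+ 2 by rewrite subr_ge0 exprn_ile1 ?ltW.
  have w1 : 1 - u ^+ 2 <= 1 by rewrite lerBlDr lerDl exprn_ge0 ?ltW.
  rewrite normrM normrX (ger0_norm w0); apply: (le_trans _ (gM l)).
  by rewrite ler_piMr // exprn_ile1.
split; first by apply: eq_integrable01 i1 => u _; rewrite expr0; ring.
have -> : (fun l => gam l *
     Rintegral mu D (fun u => powR u (c - 1) * (1 - u ^+ 2) ^+ l * expR (tau * u))) =
   (fun n => Rintegral mu D (fun u => powR u (c - 1) * (1 - u ^+ 2) ^+ 0 * expR (tau * u) *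
     (gam n * (1 - u ^+ 2) ^+ n))).
  apply/funext => l; have [i2 _] := exp_beta_int l tau c0.
  rewrite -RintegralZl //; apply: eq_Rintegral => u _; rewrite expr0; ring.
have -> : Rintegral mu D (fun u => g u * powR u (c - 1) * expR (tau * u)) =
   Rintegral mu D (fun u => powR u (c - 1) * (1 - u ^+ 2) ^+ 0 * expR (tau * u) * g u).
  by apply: eq_Rintegral => u _; rewrite expr0; ring.
exact: c1.
Qed.

Lemma int01E h : integrable01 h -> int01 h = Rintegral mu D h.
Proof.
move=> ih; rewrite /int01 /Rintegral integral_itv_bndoo //.
exact: measurable_int ih.
Qed.

End Integrals.

(** * Power series of the Bessel functions *)

Section Bessel.
Variable R : realType.
Local Notation mu := (@lebesgue_measure R).
Local Notation D := (`]0%R, 1%R[%classic : set R).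

(* Coefficients of [J_0 (r w^(1/2))] and of [r/2 w^(-1/2) J_1 (r w^(1/2))] as
   power series in [w], with [rho = r^2]. *)
Definition gam0 (rho : R) (l : nat) : R := (-1) ^+ l / (l`! * l`!)%:R * (rho / 4) ^+ l.
Definition gam1 (rho : R) (l : nat) : R :=
  (-1) ^+ l / (l`! * l.+1`!)%:R * (rho / 4) ^+ l.+1.

Lemma gam_bound (rho : R) l n : 0 <= rho ->
  `|(-1) ^+ l / (l`! * (l + n)`!)%:R * (rho / 4) ^+ l| <= exp_coeff (rho / 4) l.
Proof.
move=> rho0; have r4 : 0 <= (rho / 4) ^+ l by rewrite exprn_ge0 // divr_ge0.
rewrite !normrM normrX normrN1 expr1n mul1r (ger0_norm r4) /exp_coeff /= mulrC.
rewrite ler_wpM2l // ger0_norm ?invr_ge0 //.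
rewrite lef_pV2 ?posrE ?ltr0n ?muln_gt0 ?fact_gt0 //.
by rewrite ler_nat leq_pmulr // fact_gt0.
Qed.

Lemma gam0_bound rho l : 0 <= rho -> `|gam0 rho l| <= exp_coeff (rho / 4) l.
Proof. by move=> r0; have := gam_bound l 0 r0; rewrite addn0. Qed.

Lemma gam1_bound rho l : 0 <= rho ->
  `|gam1 rho l| <= rho / 4 * exp_coeff (rho / 4) l.
Proof.
move=> r0; have := gam_bound l 1 r0; rewrite addn1 => h.
rewrite /gam1 exprS mulrCA normrM (@ger0_norm _ (rho / 4)) ?divr_ge0 //.
by rewrite ler_wpM2l // divr_ge0.
Qed.

Lemma cvg_of_bound (a M : nat -> R) : (forall n, `|a n| <= M n) ->
  cvgn (series M) -> cvgn (series a).
Proof.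
move=> aM cM; apply: normed_cvg; apply: (series_le_cvg _ _ aM cM) => n //.
exact: le_trans (normr_ge0 _) (aM n).
Qed.

Lemma w01 (u : R) : D u -> 0 < 1 - u ^+ 2 <= 1.
Proof.
rewrite /= in_itv /= => /andP[u0 u1].
apply/andP; split; first by rewrite subr_gt0 expr_lt1 // ltW.
by rewrite lerBlDr lerDl exprn_ge0 ?ltW.
Qed.

Lemma cvg_gam (w : R) (g M : nat -> R) : 0 < w <= 1 ->
  (forall l, `|g l| <= M l) -> cvgn (series M) ->
  cvgn (series (fun l => g l * w ^+ l)).
Proof.
move=> /andP[w0 w1] gM cM; apply: (cvg_of_bound _ cM) => l.
rewrite normrM normrX (gtr0_norm w0); apply: le_trans (gM l).
by rewrite ler_piMr // exprn_ile1 // ltW.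
Qed.

Lemma bessel0_series (r w : R) : 0 < w <= 1 ->
  series (fun l => gam0 (r ^+ 2) l * w ^+ l) @ \oo --> besselJ 0 (r * powR w (1 / 2)).
Proof.
move=> w1; have w0 : 0 < w by case/andP: w1.
have c : cvgn (series (fun l => gam0 (r ^+ 2) l * w ^+ l)).
  apply: (cvg_gam w1 (fun l => gam0_bound l (sqr_ge0 r))).
  exact: is_cvg_series_exp_coeff.
suff -> : besselJ 0 (r * powR w (1 / 2)) =
    limn (series (fun l => gam0 (r ^+ 2) l * w ^+ l)) by exact: c.
rewrite /besselJ; congr (limn (series _)); apply/funext => k.
have w2 : powR w (1 / 2) ^+ 2 = w.
  by rewrite -powR_mulrn ?powR_ge0 // -powRrM mulrC mul1r mulfV // powRr1 // ltW.
rewrite !addn0 /gam0 -[RHS]mulrA; congr (_ * _).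
rewrite exprM -exprMn; congr (_ ^+ _).
by rewrite expr_div_n exprMn w2; field.
Qed.

(** The prefactor (r/2) w^{-1/2} cancels the odd power of w^{1/2} in J_1, leaving a power series in
    w that is bounded up to u = 1. *)
Lemma bessel1_series (r w : R) : 0 < w <= 1 ->
  series (fun l => gam1 (r ^+ 2) l * w ^+ l) @ \oo -->
    r / 2 * (powR w (- (1 / 2)) * besselJ 1 (r * powR w (1 / 2))).
Proof.
move=> w1; have w0 : 0 < w by case/andP: w1.
pose q := powR w (1 / 2).
have q0 : q != 0 by rewrite lt0r_neq0 // powR_gt0.
have q2 : q ^+ 2 = w.
  by rewrite -powR_mulrn ?powR_ge0 // -powRrM mulrC mul1r mulfV // powRr1 // ltW.
(* For r = 0 both sides vanish; otherwise the prefactor is inverted. *)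
have [->|r0] := eqVneq r 0.
  rewrite mul0r mul0r; apply: cvg_near_cst; apply: nearW => n.
  rewrite /series /= big1 // => l _.
  by rewrite /gam1 exprS expr2 mul0r mul0r mul0r mulr0 mul0r.
have c : cvgn (series (fun l => gam1 (r ^+ 2) l * w ^+ l)).
  apply: (cvg_gam w1 (fun l => gam1_bound l (sqr_ge0 r))).
  apply/cvg_ex; exists (r ^+ 2 / 4 * expR (r ^+ 2 / 4)); apply: cvg_seriesZ.
  exact: is_cvg_series_exp_coeff.
pose k := (r / 2 * powR w (- (1 / 2)))^-1.
have k0 : r / 2 * powR w (- (1 / 2)) != 0.
  by rewrite mulf_neq0 // ?mulf_neq0 // lt0r_neq0 // powR_gt0.
suff -> : besselJ 1 (r * powR w (1 / 2)) =
    k * limn (series (fun l => gam1 (r ^+ 2) l * w ^+ l)).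
  by rewrite mulrA mulrA mulfV // mul1r; exact: c.
have ck : series (fun l => k * (gam1 (r ^+ 2) l * w ^+ l)) @ \oo -->
    k * limn (series (fun l => gam1 (r ^+ 2) l * w ^+ l)) by apply: cvg_seriesZ; exact: c.
rewrite -(cvg_lim _ ck) //; congr (limn (series _)); apply/funext => l.
rewrite addn1 /gam1 /k powRN -/q -q2 !invfM invrK.
rewrite addn1 (exprS (r * q / 2)) exprM (_ : (r * q / 2) ^+ 2 = r ^+ 2 / 4 * q ^+ 2); last by field.
rewrite exprMn (exprS (r ^+ 2 / 4)); move: ((r ^+ 2 / 4) ^+ l) ((q ^+ 2) ^+ l) ((-1) ^+ l) => P Q S.
have f1 : ((l`! * (l.+1)`!)%:R : R) != 0 by rewrite pnatr_eq0 -lt0n muln_gt0 !fact_gt0.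
by move: ((l`! * (l.+1)`!)%:R : R) (q) f1 q0 => F q' f1 q1; field; rewrite f1 r0 q1.
Qed.

End Bessel.

(** * Power series of the integrals in the kernel *)

Section Assembly.
Variable R : realType.

Lemma eq_cvg_series (u v : nat -> R) (l : R) : u =1 v ->
  series u @ \oo --> l -> series v @ \oo --> l.
Proof. by move=> /funext ->. Qed.

Lemma cvg_seriesD (u v : nat -> R) (a b : R) : series u @ \oo --> a ->
  series v @ \oo --> b -> series (fun n => u n + v n) @ \oo --> a + b.
Proof. by move=> ua vb; rewrite [series _](seriesD u v); exact: cvgD. Qed.

Lemma cvg_series_cons (a l : R) (u : nat -> R) : series u @ \oo --> l ->
  series (fun n => if n is n'.+1 then u n' else a) @ \oo --> a + l.
Proof.
move=> ul; rewrite -cvg_shiftS.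
rewrite (_ : [sequence _]_n = (fun n => a + series u n)).
  by apply: cvgD => //; exact: cvg_cst.
by apply/funext => n; rewrite /series /= big_nat_recl.
Qed.

Variable m : nat.
Hypothesis hm : (2 < m)%N.
Local Notation mu := (@lebesgue_measure R).
Local Notation D := (`]0%R, 1%R[%classic : set R).
Local Notation ci := (0 +i* 1 : R[i]).
Local Notation lam := (half_index R m).

Section RealSums.
Variables (sg s r : R).

Let tau := sg * s.

Definition Iexp c l := Rintegral mu D
  (fun u => powR u (c - 1) * (1 - u ^+ 2) ^+ l * expR (tau * u)).

Lemma gam0_Yc l c : gam0 (r ^+ 2) l * (2 ^+ l * l`!%:R / prodc l.+1 c) =
  Yc l c * (r ^+ 2) ^+ l.
Proof.
rewrite /gam0 /Yc natrM expr_div_n (_ : 4 ^+ l = 2 ^+ l * 2 ^+ l); last first.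
  by rewrite -exprMn; congr (_ ^+ _); ring.
have : (l`!%:R : R) != 0 by rewrite pnatr_eq0 -lt0n fact_gt0.
have : (2 ^+ l : R) != 0 by rewrite expf_neq0.
rewrite !invfM; move: (prodc l.+1 c)^-1 (l`!%:R) (2 ^+ l) => P F T n1 n2; field.
by rewrite n1 n2.
Qed.

(** The l-th term of J_1 carries rho^(l+1), hence the index [l.+1]; the remaining value X_0 = 1/2 is
    the exponential term. *)
Lemma gam1_Xc l c : gam1 (r ^+ 2) l * (2 ^+ l * l`!%:R / prodc l.+1 (c + 1)) =
  - (Xc l.+1 c * (r ^+ 2) ^+ l.+1).
Proof.
rewrite /gam1 /Xc natrM expr_div_n (_ : 4 ^+ l.+1 = 4 * (2 ^+ l * 2 ^+ l)); last first.
  by rewrite -exprMn exprS; congr (_ * _ ^+ _); ring.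
rewrite (exprS (-1)) !(exprS 2).
have : (l`!%:R : R) != 0 by rewrite pnatr_eq0 -lt0n fact_gt0.
have : ((l.+1)`!%:R : R) != 0 by rewrite pnatr_eq0 -lt0n fact_gt0.
have : (2 ^+ l : R) != 0 by rewrite expf_neq0.
rewrite !invfM; move: (prodc l.+1 (c + 1))^-1 (l`!%:R) ((l.+1)`!%:R) (2 ^+ l).
by move=> P F F1 T n1 n2 n3; field; rewrite n1 n2 n3.
Qed.

Let lam0 : 0 < lam := lam_gt0 R hm.
Let lam1 : 0 < lam + 1. Proof. by rewrite addr_gt0. Qed.

Lemma Yc_sum c l : 0 < c ->
  series (fun p => tau ^+ p / p`!%:R * (Yc l (c + p%:R) * (r ^+ 2) ^+ l)) @ \oo -->
   gam0 (r ^+ 2) l * Iexp c l.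
Proof.
move=> c0; have [_ h] := exp_beta_int l tau c0.
have := cvg_seriesZ (a := gam0 (r ^+ 2) l) h.
by apply: eq_cvg_series => p; rewrite -gam0_Yc; ring.
Qed.

(** [lam + 1] appears because u has the exponent m/2 - 1 = (lambda + 1) - 1 in the J_1 integral. *)
Lemma Xc_sum l :
  series (fun p => tau ^+ p / p`!%:R * (Xc l (lam + p%:R) * (r ^+ 2) ^+ l)) @ \oo -->
   (if l is l'.+1 then - (gam1 (r ^+ 2) l' * Iexp (lam + 1) l') else expR tau / 2).
Proof.
case: l => [|l].
  rewrite (_ : (fun p => _) = (fun p => 2^-1 * exp_coeff tau p)).
    by rewrite mulrC; apply: cvg_seriesZ; exact: is_cvg_series_exp_coeff.
  by apply/funext => p; rewrite Xc0 expr0 /exp_coeff /=; ring.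
have [_ h] := exp_beta_int l tau lam1.
have := cvg_seriesZ (a := - gam1 (r ^+ 2) l) h; rewrite mulNr.
apply: eq_cvg_series => p.
have -> : lam + 1 + p%:R = lam + p%:R + 1 by ring.
by rewrite mulrCA mulNr gam1_Xc opprK.
Qed.

Lemma Yc_series c (a : R) : a = c - 1 -> 0 < c ->
  series (fun l => gam0 (r ^+ 2) l * Iexp c l) @ \oo -->
  int01 (fun u => besselJ 0 (r * powR (1 - u ^+ 2) (1 / 2)) * powR u a * expR (sg * s * u)).
Proof.
move=> -> c0.
have [i1 c1] := bessel_beta_int tau c0 (fun l => gam0_bound l (sqr_ge0 r))
  (is_cvg_series_exp_coeff _) (fun u Du => @bessel0_series R r _ (w01 Du)).
by rewrite int01E.
Qed.

Lemma Xc_series :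
  series (fun l => if l is l'.+1 then - (gam1 (r ^+ 2) l' * Iexp (lam + 1) l')
                   else expR tau / 2) @ \oo -->
  expR (sg * s) / 2 - r / 2 * int01 (fun u => powR (1 - u ^+ 2) (- (1 / 2))
              * besselJ 1 (r * powR (1 - u ^+ 2) (1 / 2))
              * powR u (m%:R / 2 - 1) * expR (sg * s * u)).
Proof.
pose J u := powR (1 - u ^+ 2) (- (1 / 2)) * besselJ 1 (r * powR (1 - u ^+ 2) (1 / 2)).
have [i1 c1] := bessel_beta_int tau lam1 (fun l => gam1_bound l (sqr_ge0 r))
  (cvg_seriesZ (is_cvg_series_exp_coeff _)) (fun u Du => @bessel1_series R r _ (w01 Du)).
have E : Rintegral mu D (fun u => r / 2 * J u * powR u (lam + 1 - 1) * expR (tau * u)) =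
   r / 2 * int01 (fun u => J u * powR u (m%:R / 2 - 1) * expR (sg * s * u)).
  have -> : m%:R / 2 - 1 = lam + 1 - 1 by rewrite addrK.
  (* Integrability of the J_1 integrand is known only with the factor r/2 and is recovered by
     division; for r = 0 both sides are 0. *)
  have [->|r0] := eqVneq r 0.
    rewrite !mul0r (@eq_Rintegral _ _ _ mu D (cst 0)); last first.
      by move=> u _; rewrite !mul0r.
    by rewrite Rintegral_cst ?mul0r //; exact: measurableD01.
  have i2 : integrable01 (fun u => J u * powR u (lam + 1 - 1) * expR (sg * s * u)).
    apply: eq_integrable01 (integrable01Z (r / 2)^-1 i1) => u _.
    by rewrite -/(J u) /tau; field.
  rewrite int01E // -RintegralZl //.
  by apply: eq_Rintegral => u _; rewrite /tau; ring.
rewrite -E.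
have := cvg_series_cons (a := expR tau / 2) (cvg_seriesZ (a := -1) c1).
by rewrite mulN1r; apply: eq_cvg_series => -[|n] //; rewrite mulN1r.
Qed.

Lemma branch_scal_sums : exists Y : nat -> R,
  (forall l, series (fun p => branch_scal m sg l p * s ^+ p * (r ^+ 2) ^+ l) @ \oo --> Y l) /\
  series Y @ \oo -->
  expR (sg * s) / 2 - r / 2 * int01 (fun u => powR (1 - u ^+ 2) (- (1 / 2))
              * besselJ 1 (r * powR (1 - u ^+ 2) (1 / 2))
              * powR u (m%:R / 2 - 1) * expR (sg * s * u))
  - sg * ((m%:R - 2) / 4) *
    int01 (fun u => besselJ 0 (r * powR (1 - u ^+ 2) (1 / 2)) *
       powR u (m%:R / 2 - 2) * expR (sg * s * u)).
Proof.
have a2 : m%:R / 2 - 2 = lam - 1 by rewrite /half_index; ring.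
pose k := - (sg * (lam / 2)).
exists (fun l => (if l is l'.+1 then - (gam1 (r ^+ 2) l' * Iexp (lam + 1) l')
                   else expR tau / 2) + k * (gam0 (r ^+ 2) l * Iexp lam l)).
split => [l|].
  have := cvg_seriesD (@Xc_sum l) (cvg_seriesZ (a := k) (@Yc_sum lam l lam0)).
  apply: eq_cvg_series => p.
  by rewrite /branch_scal /k /tau exprMn; ring.
have -> : (m%:R - 2) / 4 = lam / 2 by rewrite /half_index; field.
rewrite -[- (sg * (lam / 2) * _)]mulNr -/k.
exact: (cvg_seriesD Xc_series (cvg_seriesZ (Yc_series a2 lam0))).
Qed.

Lemma branch_biv_sums : exists Y : nat -> R,
  (forall l, series (fun p => branch_biv m sg l p * s ^+ p * (r ^+ 2) ^+ l) @ \oo --> Y l) /\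
  series Y @ \oo -->
  1 / 2 * int01 (fun u => besselJ 0 (r * powR (1 - u ^+ 2) (1 / 2)) *
       powR u (m%:R / 2 - 1) * expR (sg * s * u)).
Proof.
have a1 : m%:R / 2 - 1 = lam + 1 - 1 by rewrite addrK.
exists (fun l => 1 / 2 * (gam0 (r ^+ 2) l * Iexp (lam + 1) l)).
split => [l|]; last by apply: cvg_seriesZ; exact: Yc_series.
have := cvg_seriesZ (a := 1 / 2) (@Yc_sum (lam + 1) l lam1).
apply: eq_cvg_series => p.
have -> : lam + 1 + p%:R = lam + p.+1%:R by rewrite -natr1; ring.
by rewrite /branch_biv /tau exprMn; field.
Qed.

End RealSums.

End Assembly.

(** * The kernel *)

Section Kernel.
Variable R : realType.
Variable m : nat.
Hypothesis hm : (2 < m)%N.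
Local Notation ci := (0 +i* 1 : R[i]).

Lemma cunit_ci_mi j k : cunit (ci ^+ j * minus_i R ^+ k).
Proof.
elim: j => [|j IH]; first by rewrite expr0 mul1r; exact: cunit_mi_exp.
by rewrite exprS -mulrA; exact: (@cunit_mul_i R true).
Qed.

(** pi/2 from the exponent times 2 (k + m) from [coef_bound] gives the argument pi (k + m). *)
Lemma exp_weight_bound j k q (t : R) :
  `|t| <= (2 * (k + m)%:R) ^+ j / k`!%:R ->
  `|complex.Re (exp_weight R j * (minus_i R ^+ q * t%:C))| <=
     exp_coeff (pi * (k + m)%:R) j / k`!%:R /\
  `|complex.Im (exp_weight R j * (minus_i R ^+ q * t%:C))| <=
     exp_coeff (pi * (k + m)%:R) j / k`!%:R.
Proof.
move=> tB.
have -> : exp_weight R j * (minus_i R ^+ q * t%:C) =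
   (ci ^+ j * minus_i R ^+ q) * ((pi / 2) ^+ j / j`!%:R * t)%:C.
  by rewrite /exp_weight rcM; ring.
apply: cunit_scale; first exact: cunit_ci_mi.
have p0 : 0 <= (pi / 2) ^+ j / j`!%:R :> R.
  by rewrite divr_ge0 // exprn_ge0 // divr_ge0 // pi_ge0.
rewrite normrM (ger0_norm p0); apply: (le_trans (ler_wpM2l p0 tB)).
rewrite /exp_coeff /= (_ : pi * (k + m)%:R = pi / 2 * (2 * (k + m)%:R)); last by field.
rewrite le_eqVlt; apply/orP; left; apply/eqP; rewrite [in RHS]exprMn.
by move: (_ ^+ j) (_ ^+ j) (j`!%:R)^-1 (k`!%:R)^-1 => a b c d; ring.
Qed.

Lemma scal_cf_bound j l p :
  let k := (p + 2 * l + 0)%N in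
  `|complex.Re (exp_weight R j * scal_cf R m j l p)| <= exp_coeff (pi * (k + m)%:R) j / k`!%:R /\
  `|complex.Im (exp_weight R j * scal_cf R m j l p)| <= exp_coeff (pi * (k + m)%:R) j / k`!%:R.
Proof.
by move=> k; apply: exp_weight_bound; rewrite /k addn0; exact: (coef_bound R hm j l p).1.
Qed.

Lemma biv_cf_bound j l p :
  let k := (p + 2 * l + 1)%N in
  `|complex.Re (exp_weight R j * biv_cf R m j l p)| <= exp_coeff (pi * (k + m)%:R) j / k`!%:R /\
  `|complex.Im (exp_weight R j * biv_cf R m j l p)| <= exp_coeff (pi * (k + m)%:R) j / k`!%:R.
Proof.
move=> k; apply: exp_weight_bound; rewrite /k addn1 -addSn.
exact: (coef_bound R hm j l p).2.
Qed.

Lemma csums_real (a : nat -> R) (l : R) : series a @ \oo --> l ->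
  csums (fun n => (a n)%:C) l%:C.
Proof.
move=> al; split => //=; apply: cvg_near_cst; apply: nearW => n.
by rewrite /series /= big1.
Qed.

Lemma csums_kernel (K : R -> nat -> nat -> R) (V : R -> R) (s r : R) (k : R[i]) :
  (forall sg, exists Y : nat -> R,
    (forall l, series (fun p => K sg l p * s ^+ p * (r ^+ 2) ^+ l) @ \oo --> Y l) /\
    series Y @ \oo --> V sg) ->
  exists Y : nat -> R[i],
    (forall l, csums (fun p => ((K (-1) l p)%:C - k * (K 1 l p)%:C) *
       (s ^+ p)%:C * ((r ^+ 2) ^+ l)%:C) (Y l)) /\
    csums Y ((V (-1))%:C - k * (V 1)%:C).
Proof.
move=> KV; have [Y1 [h1 v1]] := KV (-1); have [Y2 [h2 v2]] := KV 1.
exists (fun l => (Y1 l)%:C + - k * (Y2 l)%:C); split => [l|].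
  apply: eq_csums (csumsD (csums_real (h1 l)) (csumsZ (- k) (csums_real (h2 l)))) => p.
  by rewrite !rcM; ring.
by rewrite -mulNr; exact: (csumsD (csums_real v1) (csumsZ (- k) (csums_real v2))).
Qed.

Lemma ccvgD (y1 y2 : nat -> R[i]) z1 z2 : ccvg y1 z1 -> ccvg y2 z2 ->
  ccvg (fun n => y1 n + y2 n) (z1 + z2).
Proof.
move=> [a1 a2] [b1 b2]; split.
  by rewrite cReD; under eq_fun do rewrite cReD; exact: cvgD.
by rewrite cImD; under eq_fun do rewrite cImD; exact: cvgD.
Qed.

Lemma cl_addE (a b : cl R m) A : (a + b) A = a A + b A.
Proof. by rewrite ffunE. Qed.

Lemma cl_oppE (a : cl R m) A : (- a) A = - a A.
Proof. by rewrite ffunE. Qed.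

Lemma cl_scaleE k (a : cl R m) A : (k *: a) A = k * a A.
Proof. by rewrite ffunE. Qed.

Lemma CF_partialE (x y : 'rV[R]_m) n : CF_partial x y n =
  cl_scal m (\sum_(0 <= j < n) exp_weight R j * Fn m j (dotp x y) (rho x y)) +
  (\sum_(0 <= j < n) exp_weight R j * Gn m j (dotp x y) (rho x y)) *: wedge x y.
Proof.
rewrite /CF_partial !big_mkord /cl_scal !scaler_suml -big_split; apply: eq_bigr => j _ /=.
have -> : ('i * (pi / 2)%:C) ^+ j / (j`!)%:R = exp_weight R j.
  have E : ((j`!%:R : R)^-1)%:C = (j`!%:R)^-1 :> R[i] by rewrite -rcn; exact: fmorphV.
  by rewrite /exp_weight -complexiE exprMn -rcX [in RHS]rcM E mulrA.
by rewrite (iter_Gamma hm x j) /cl_scal scalerDr !scalerA.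
Qed.

End Kernel.

Theorem theorem6 (R : realType) (m : nat) (hm : (3 <= m)%N)
  (x y : 'rV[R]_m) :
  let s := dotp x y in
  let r := vnorm x * vnorm y in
  let w := fun u : R => 1 - u ^+ 2 in
  let I1 := fun sg : R => int01 (fun u => powR (w u) (- (1 / 2))
              * besselJ 1 (r * powR (w u) (1 / 2))
              * powR u (m%:R / 2 - 1) * expR (sg * s * u)) in
  let I2 := fun sg : R => int01 (fun u =>
                besselJ 0 (r * powR (w u) (1 / 2))
              * powR u (m%:R / 2 - 2) * expR (sg * s * u)) in
  let I3 := fun sg : R => int01 (fun u =>
                besselJ 0 (r * powR (w u) (1 / 2))
              * powR u (m%:R / 2 - 1) * expR (sg * s * u)) in
  cl_cvg_to (CF_partial x y)
    (@cl_scal R m ((expR (- s) / 2 - r / 2 * I1 (-1) + (m%:R - 2) / 4 * I2 (-1))%:C)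
     + ((1 / 2 * I3 (-1))%:C *: wedge x y)
     - cexpi (m%:R * pi / 2) *:
        (@cl_scal R m ((expR s / 2 - r / 2 * I1 1 - (m%:R - 2) / 4 * I2 1)%:C)
         + ((1 / 2 * I3 1)%:C *: wedge x y))).
Proof.
move=> s r w I1 I2 I3.
have r2 : r ^+ 2 = rho x y.
  have dge0 (z : 'rV[R]_m) : 0 <= dotp z z.
    by apply: sumr_ge0 => j _; rewrite -expr2 sqr_ge0.
  by rewrite /r /rho exprMn !sqr_sqrtr.
have [Ya [Ya1 Ya2]] := csums_kernel (cexpi (m%:R * pi / 2)) (fun sg => branch_scal_sums hm sg s r).
have [Yb [Yb1 Yb2]] := csums_kernel (cexpi (m%:R * pi / 2)) (fun sg => branch_biv_sums hm sg s r).
have {}Ya2 : csums Ya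
    ((expR (- s) / 2 - r / 2 * I1 (-1) + (m%:R - 2) / 4 * I2 (-1))%:C -
     cexpi (m%:R * pi / 2) * (expR s / 2 - r / 2 * I1 1 - (m%:R - 2) / 4 * I2 1)%:C).
  (* Both halves are brought to the common form with [sg]; for sg = -1 the double minus gives the
     plus sign before the J_0 integral. *)
  have -> : expR (- s) / 2 - r / 2 * I1 (-1) + (m%:R - 2) / 4 * I2 (-1) =
     expR (-1 * s) / 2 - r / 2 * I1 (-1) - -1 * ((m%:R - 2) / 4) * I2 (-1).
    by rewrite mulN1r; ring.
  have -> : expR s / 2 - r / 2 * I1 1 - (m%:R - 2) / 4 * I2 1 =
     expR (1 * s) / 2 - r / 2 * I1 1 - 1 * ((m%:R - 2) / 4) * I2 1.
    by rewrite (mul1r s); ring.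
  exact: Ya2.
have cF := csums_exchange (entire_scal_cf R hm) (@scal_cf_eq0 R m) (csums_scal_cf R hm)
  (@scal_cf_bound R m hm) Ya1 Ya2.
have cG := csums_exchange (entire_biv_cf R hm) (@biv_cf_eq0 R m) (csums_biv_cf R hm)
  (@biv_cf_bound R m hm) Yb1 Yb2.
move/csums_ccvg: cF => cF; move/csums_ccvg: cG => cG A.
(* At a fixed coordinate [A] the elements 1 and B are constants, so the two scalar limits combine
   linearly. *)
have cA := ccvgD (ccvgM (cl_blade R (finset.set0) A) cF) (ccvgM (wedge x y A) cG).
set V := _ - _ *: _; suff : ccvg (fun n => CF_partial x y n A) (V A) by [].
have -> : (fun n => CF_partial x y n A) = (fun n =>
   (\sum_(0 <= j < n) exp_weight R j * Fn m j s (r ^+ 2)) * cl_blade R (finset.set0) A +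
   (\sum_(0 <= j < n) exp_weight R j * Gn m j s (r ^+ 2)) * wedge x y A).
  apply/funext => n; by rewrite (CF_partialE hm) r2 /cl_scal cl_addE !cl_scaleE.
have -> : V A = ((expR (- s) / 2 - r / 2 * I1 (-1) + (m%:R - 2) / 4 * I2 (-1))%:C -
     cexpi (m%:R * pi / 2) * (expR s / 2 - r / 2 * I1 1 - (m%:R - 2) / 4 * I2 1)%:C) *
     cl_blade R (finset.set0) A +
   ((1 / 2 * I3 (-1))%:C - cexpi (m%:R * pi / 2) * (1 / 2 * I3 1)%:C) * wedge x y A.
  rewrite /V /cl_scal !(cl_addE, cl_oppE, cl_scaleE).
  move: (_%:C) (_%:C) (_%:C) (_%:C) (cexpi _) (cl_blade _ _ _) (wedge _ _ _).
  by move=> a1 a2 a3 a4 c p q; ring.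
exact: cA.
Qed.
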